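(* Let $M=2m$, $N=2n+1$, let $L\ge 1$, and put $L=2l$ or $L=2l+1$ according as $L$ is even or odd. Let $i_1,\dots,i_m$ and $j_1,\dots,j_n$ be non-negative integers with $j_b\le l$ for all $b$ and $i_a=0$ for $a>\min(m,l)$, and consider the vector $v=\Lambda R\in F^L$, where $\Lambda=\Lambda(i_1,\dots,i_m)=\prod_{a}\Lambda_a^{i_a}$ and $R=R(j_1,\dots,j_n)=\prod_{b=1}^nR_b(j_b)\cdot C$ ($R=C$ if $N=1$). If $0\le j_1\le j_2\le\cdots\le j_n$ and $i_a=0$ for $a>j_1$ (conditions involving the $j_b$ being void when $n=0$), then $v$ is a primitive vector for $\Delta^-$ in the representation $(\tilde\rho,F^L)$ of $\mathfrak{osp}(M/N;\mathbb{R})$.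
   Context: Lie superalgebra. $\mathfrak{osp}(M/N;\mathbb{R})$ ($M=2m$, $N=2n+1$) is the real Lie superalgebra of matrices preserving (in the super sense $b(Xv,w)+(-1)^{\deg X\deg v}b(v,Xw)=0$) the form $b(v,w)={}^tvBw$ on $V=\mathbb{R}^{M}\oplus\mathbb{R}^{N}$ (even part $\mathbb{R}^M$, odd part $\mathbb{R}^N$), $B$ block diagonal with blocks $\begin{pmatrix}0&1_m\\-1_m&0\end{pmatrix}$ and $1_N$. The Cartan subalgebra $\mathfrak{h}$ consists of block diagonal matrices with blocks $\begin{pmatrix}0&A\\-A&0\end{pmatrix}$, $A=\mathrm{diag}(a_1,\dots,a_m)$, and $\mathrm{diag}(b_1u,\dots,b_nu,0)$, $u=\begin{pmatrix}0&1\\-1&0\end{pmatrix}$; $e_i(h)=\sqrt{-1}\,a_i$, $f_j(h)=\sqrt{-1}\,b_j$. The positive roots $\Delta^+$ are $e_i-e_j$ ($i<j$), $e_i+e_j$ ($i\le j$), $f_i\pm f_j$ ($i<j$), $f_j$ (even) and $e_i\pm f_j$, $e_i$ (odd); $\Delta^-=-\Delta^+$. A primitive vector for $\Delta^-$ is a non-zero vector annihilated by all root vectors $X_\alpha$, $\alpha\in\Delta^-$. Representation. $F^L=\mathbb{C}[z_{s,k}\mid 1\le s\le m,1\le k\le L]\otimes C^{\mathbb{C}}(r_{t,k},c_k\mid 1\le t\le n,1\le k\le L)$, where the second factor is the complex Clifford algebra whose generators have square $1$ and pairwise anticommute. Let $\alpha_{t,k}$ be the automorphism of the Clifford algebra sending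 $r_{t,k}$ to $-r_{t,k}$ and fixing all other generators. Let $\zeta$ be a fourth root of $-1$ with $\zeta^2=\sqrt{-1}$. Put $\rho^L(p_{s,k})=\frac{\sqrt{-1}\,\zeta}{\sqrt2}\bigl(z_{s,k}-\frac{\partial}{\partial z_{s,k}}\bigr)$, $\rho^L(q_{s,k})=\frac{\zeta}{\sqrt2}\bigl(z_{s,k}+\frac{\partial}{\partial z_{s,k}}\bigr)$, $\rho^L(r_{t,k})=r_{t,k}$ (left multiplication), $\rho^L(s_{t,k})=\sqrt{-1}\,r_{t,k}\alpha_{t,k}$, $\rho^L(c_k)=c_k$ (left multiplication). Let $p_s,q_s$ be the standard symplectic basis of $V_{\bar 0}$ ($b(p_s,q_t)=\delta_{s,t}$; $p_s$, $q_s$ the $s$-th and $(m+s)$-th coordinate vectors) and let $r_t,s_t,c$ be $\sqrt2$ times the $(2t-1)$-th, $2t$-th and $N$-th coordinate vectors of $V_{\bar 1}$. In the Clifford–Weyl superalgebra generated by these (with $[x,y]=b(x,y)$ for the supercommutator of generators), the elements $m(x,y)=xy+(-1)^{\deg x\deg y}yx$ span a Lie superalgebra identified with $\mathfrak{osp}(M/N;\mathbb{R})$ via $\mathrm{ad}$ acting on $V$; the representation is $\tilde\rho(m(x,y))=\sum_{k=1}^L\bigl(\rho^L(x_k)\rho^L(y_k)+(-1)^{\deg x\deg y}\rho^L(y_k)\rho^L(x_k)\bigr)$ for generators $x,y$, where $x_k$ is the $k$-th copy of $x$ (e.g. $p_{s,k}$ for $x=p_s$), extended linearly to the complexification. (This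 is the restriction of the oscillator representation of $\mathfrak{osp}(ML/NL;\mathbb{R})$ along $A\mapsto A\otimes 1_L$.) Vectors. For $1\le a\le\min(m,l)$: $\Lambda_a=\det\bigl(z_{s,2k-1}+\sqrt{-1}\,z_{s,2k}\bigr)_{m-a<s\le m,\ 1\le k\le a}$. For $1\le b\le n$ and $0\le j\le l$: $R_b(j)=\prod_{k=1}^{j}(r_{b,2k-1}+\sqrt{-1}\,r_{b,2k})\prod_{k'=2j+1}^{L}r_{b,k'}$. And $C=\prod_{k=1}^{l}(c_{2k-1}+\sqrt{-1}\,c_{2k})$. Empty products are $1$; the order of the factors in $R$ only affects $R$ by a sign. *)

(* Defs.v *)
From HB Require Import structures.
From mathcomp Require Import all_boot all_order all_algebra.
From mathcomp Require Import complex mpoly ring.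
From mathcomp Require Export reals.
Set Implicit Arguments.
Unset Strict Implicit.
Unset Printing Implicit Defensive.
Import Order.TTheory GRing.Theory Num.Theory.
Local Open Scope ring_scope.

(* The Clifford algebra over K on generators e_0, ..., e_{d-1} with            *)
(* e_i ^ 2 = 1 and e_i e_j = - e_j e_i: the free K-module on the ordered       *)
(* monomials e_A, A a set of indices, multiplied by                            *)
(* e_A e_B = (-1)^#{(a, b) in A x B | b < a} e_(A symmetric-difference B).      *)

Definition symdiff (T : finType) (A B : {set T}) : {set T} :=
  [set x | (x \in A) (+) (x \in B)].

Definition reorder_sign (K : comNzRingType) d (A B : {set 'I_d}) : K :=
  \prod_(a in A) \prod_(b in B | (b < a)%N) (-1).

Definition cliff (K : comNzRingType) (d : nat) := {ffun {set 'I_d} -> K^o}.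

Definition cliff_mul (K : comNzRingType) d (x y : cliff K d) : cliff K d :=
  [ffun S => \sum_(A : {set 'I_d})
     reorder_sign K A (symdiff A S) * (x A * y (symdiff A S))].

Definition cliff_one (K : comNzRingType) d : cliff K d :=
  [ffun S => (S == set0)%:R].

HB.instance Definition _ (K : comNzRingType) d :=
  GRing.Lmodule.copy (cliff K d) {ffun {set 'I_d} -> K^o}.

Section CliffRing.
Variables (K : comNzRingType) (d : nat).
Implicit Types (A B S : {set 'I_d}) (x y z : cliff K d).
Local Notation sg := (reorder_sign K).
Local Notation "A ^^ B" := (symdiff A B) (at level 40).

Let sdC A B : A ^^ B = B ^^ A.
Proof. by apply/setP=> a; rewrite !inE addbC. Qed.
Let sdA A B S : A ^^ (B ^^ S) = (A ^^ B) ^^ S.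
Proof. by apply/setP=> a; rewrite !inE addbA. Qed.
Let sdK A B : A ^^ (A ^^ B) = B.
Proof. by apply/setP=> a; rewrite !inE addbA addbb. Qed.
Let sd0 A : A ^^ set0 = A.
Proof. by apply/setP=> a; rewrite !inE addbF. Qed.
Let sd0l A : set0 ^^ A = A.
Proof. by apply/setP=> a; rewrite !inE. Qed.
Let sdI A : A ^^ A = set0.
Proof. by apply/setP=> a; rewrite !inE addbb. Qed.

Let sgE A B : sg A B = \prod_a \prod_b
  (-1) ^+ [&& a \in A, b \in B & (b < a)%N].
Proof.
rewrite /reorder_sign big_mkcond; apply: eq_bigr => a _.
case: (a \in A) => /=; last by rewrite big1.
rewrite big_mkcond; apply: eq_bigr => b _.
by case: (_ && _).
Qed.

Let sgDl A B S : sg (A ^^ B) S = sg A S * sg B S.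
Proof.
rewrite !sgE -big_split; apply: eq_bigr => a _.
rewrite -big_split; apply: eq_bigr => b _ /=.
rewrite inE -signr_addb; congr (_ ^+ nat_of_bool _).
by case: (a \in A); case: (a \in B); case: (b \in S); case: (b < a)%N.
Qed.

Let sgDr S A B : sg S (A ^^ B) = sg S A * sg S B.
Proof.
rewrite !sgE -big_split; apply: eq_bigr => a _.
rewrite -big_split; apply: eq_bigr => b _ /=.
rewrite inE -signr_addb; congr (_ ^+ nat_of_bool _).
by case: (a \in S); case: (b \in A); case: (b \in B); case: (b < a)%N.
Qed.

Let sg0l A : sg set0 A = 1.
Proof. by rewrite /reorder_sign big1 // => a; rewrite inE. Qed.
Let sg0r A : sg A set0 = 1.
Proof.
by rewrite /reorder_sign big1 // => a _; rewrite big1 // => b; rewrite inE.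
Qed.

Let sd_bij A : {on [pred _ | true], bijective (symdiff A)}.
Proof. by exists (symdiff A) => B _; apply: sdK. Qed.

Lemma cliff_mulA : associative (@cliff_mul K d).
Proof.
move=> x y z; apply/ffunP=> S; rewrite !ffunE.
transitivity (\sum_A \sum_B sg A (A ^^ S) * sg B (B ^^ (A ^^ S)) *
   (x A * y B * z (B ^^ (A ^^ S)))).
  apply: eq_bigr => A _; rewrite ffunE !mulr_sumr; apply: eq_bigr => B _.
  by rewrite -!mulrA; congr (_ * _); rewrite mulrCA.
transitivity (\sum_D \sum_A sg D (D ^^ S) * sg A (A ^^ D) *
   (x A * y (A ^^ D) * z (D ^^ S))); last first.
  apply: eq_bigr => D _; rewrite ffunE mulr_suml mulr_sumr.
  by apply: eq_bigr => A _; rewrite -!mulrA.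
rewrite [RHS]exchange_big; apply: eq_bigr => A _ /=.
rewrite [RHS](reindex _ (sd_bij A)) /=; apply: eq_bigr => B _.
rewrite sdK (sdA B) (sdC B A); set X := (A ^^ B) ^^ S.
have -> : A ^^ S = B ^^ X.
  by rewrite /X (sdC A B) -sdA sdK.
rewrite sgDr sgDl; congr (_ * _).
by rewrite [RHS]mulrC mulrA.
Qed.

Lemma cliff_mul1 : left_id (cliff_one K d) (@cliff_mul K d).
Proof.
move=> x; apply/ffunP=> S; rewrite ffunE (bigD1 set0) //= big1 ?addr0.
  by rewrite ffunE eqxx sd0l sg0l !mul1r.
by move=> A nA; rewrite ffunE (negPf nA) mul0r mulr0.
Qed.

Lemma cliff_mulr1 : right_id (cliff_one K d) (@cliff_mul K d).
Proof.
move=> x; apply/ffunP=> S; rewrite ffunE (bigD1 S) //= big1 ?addr0.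
  by rewrite ffunE sdI eqxx sg0r mul1r mulr1.
move=> A nA; rewrite ffunE; case: eqP => [e|]; last by rewrite !mulr0.
by move: nA; rewrite -[A]sd0 -e sdK eqxx.
Qed.

Lemma cliff_mulDl : left_distributive (@cliff_mul K d) +%R.
Proof.
move=> x y z; apply/ffunP=> S; rewrite !ffunE -big_split.
by apply: eq_bigr => A _; rewrite !ffunE mulrDl mulrDr.
Qed.

Lemma cliff_mulDr : right_distributive (@cliff_mul K d) +%R.
Proof.
move=> x y z; apply/ffunP=> S; rewrite !ffunE -big_split.
by apply: eq_bigr => A _; rewrite !ffunE mulrDr mulrDr.
Qed.

Lemma cliff_one_neq0 : cliff_one K d != 0.
Proof.
apply/eqP => /ffunP /(_ set0); rewrite !ffunE eqxx.
by apply/eqP; exact: oner_neq0.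
Qed.

Lemma cliff_scaleAl (a : K) x y :
  a *: cliff_mul x y = cliff_mul (a *: x) y.
Proof.
apply/ffunP=> S; rewrite !ffunE scaler_sumr; apply: eq_bigr => A _.
by rewrite !ffunE -[a *: _]/(a * _) mulrCA; congr (_ * _); rewrite mulrA.
Qed.

Lemma cliff_scaleAr (a : K) x y :
  a *: cliff_mul x y = cliff_mul x (a *: y).
Proof.
apply/ffunP=> S; rewrite !ffunE scaler_sumr; apply: eq_bigr => A _.
by rewrite !ffunE -[a *: _]/(a * _) mulrCA; congr (_ * _); rewrite mulrCA.
Qed.
End CliffRing.

HB.instance Definition _ (K : comNzRingType) d :=
  GRing.Zmodule_isNzRing.Build (cliff K d) (@cliff_mulA K d)
    (@cliff_mul1 K d) (@cliff_mulr1 K d) (@cliff_mulDl K d)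
    (@cliff_mulDr K d) (@cliff_one_neq0 K d).
HB.instance Definition _ (K : comNzRingType) d :=
  GRing.Lmodule_isLalgebra.Build K (cliff K d) (@cliff_scaleAl K d).
HB.instance Definition _ (K : comNzRingType) d :=
  GRing.Lalgebra_isAlgebra.Build K (cliff K d) (@cliff_scaleAr K d).

Definition cliff_gen (K : comNzRingType) d (g : 'I_d) : cliff K d :=
  [ffun S => (S == [set g])%:R].

Definition cliff_flip (K : comNzRingType) d (g : 'I_d) (x : cliff K d) :
  cliff K d := [ffun S : {set 'I_d} => (-1) ^+ (g \in S) * x S].

Section CliffGen.
Variables (K : comNzRingType) (d : nat).
Implicit Types (g h : 'I_d) (x y : cliff K d) (A B : {set 'I_d}).

Definition cliff_basis A : cliff K d := [ffun S => (S == A)%:R].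

Lemma cliff_basisM A B :
  cliff_basis A * cliff_basis B =
  reorder_sign K A B *: cliff_basis (symdiff A B).
Proof.
apply/ffunP=> S; rewrite !ffunE (bigD1 A) //= big1 ?addr0; last first.
  by move=> D nD; rewrite ffunE (negPf nD) mul0r mulr0.
rewrite !ffunE eqxx mul1r -[_ *: _]/(_ * _).
have -> : (symdiff A S == B) = (S == symdiff A B).
  apply/eqP/eqP => [<-|->];
  by apply/setP=> a; rewrite !inE addbA addbb.
by case: eqP => [->|]; rewrite ?mulr0 //; congr (reorder_sign _ _ _ * _);
  apply/setP=> a; rewrite !inE addbA addbb.
Qed.

Lemma cliff_gen_sqr g : cliff_gen K g * cliff_gen K g = 1.
Proof.
rewrite (cliff_basisM [set g] [set g]) /reorder_sign big_set1 big1 ?scale1r.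
  apply/ffunP=> S; rewrite !ffunE; congr (_ == _)%:R.
  by apply/setP=> a; rewrite !inE addbb.
by move=> b; rewrite inE => /andP[/eqP-> ]; rewrite ltnn.
Qed.

Lemma cliff_gen_anticomm g h : g != h ->
  cliff_gen K g * cliff_gen K h = - (cliff_gen K h * cliff_gen K g).
Proof.
move=> ngh; rewrite (cliff_basisM [set g] [set h]) (cliff_basisM [set h] [set g]).
rewrite -scaleNr; congr (_ *: cliff_basis _); last first.
  by apply/setP=> a; rewrite !inE addbC.
rewrite /reorder_sign !big_set1.
rewrite (eq_bigl (fun b => (b == h) && (h < g)%N)); last first.
  by move=> b; rewrite inE; case: eqP => [->|].
rewrite [in RHS](eq_bigl (fun b => (b == g) && (g < h)%N)); last first.
  by move=> b; rewrite inE; case: eqP => [->|].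
rewrite !big_mkcondr !big_pred1_eq.
by case: (ltngtP h g) ngh => [_ _|_ _|/ord_inj->]; rewrite ?opprK ?eqxx.
Qed.

Lemma cliff_flipM g : {morph @cliff_flip K d g : x y / x * y}.
Proof.
move=> x y; apply/ffunP=> S; rewrite !ffunE mulr_sumr.
apply: eq_bigr => A _; rewrite !ffunE !inE signr_addb.
set u := _ ^+ (g \in A); set w := _ ^+ (g \in S).
have uu : u * u = 1 by rewrite -signr_addb addbb.
transitivity (u * u * (w * (reorder_sign K A (symdiff A S) *
  ((x : {ffun _ -> K}) A * (y : {ffun _ -> K}) (symdiff A S))))).
  by rewrite uu mul1r.
by move: (x A) (y _) => a b; ring.
Qed.

Lemma cliff_flip1 g : cliff_flip g 1 = 1 :> cliff K d.
Proof.
apply/ffunP=> S; rewrite !ffunE.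
by case: eqP => [->|]; rewrite ?mulr0 // inE mul1r.
Qed.

Lemma cliff_flip_linear g : linear (@cliff_flip K d g).
Proof.
move=> a x y; apply/ffunP=> S; rewrite !ffunE mulrDr.
by congr (_ + _); rewrite -[a *: _]/(a * _) -[a *: _]/(a * _) mulrCA.
Qed.

Lemma cliff_flip_gen g h :
  cliff_flip g (cliff_gen K h) = (-1) ^+ (g == h) *: cliff_gen K h.
Proof.
apply/ffunP=> S; rewrite !ffunE -[_ *: _]/(_ * _).
by case: (S =P _) => [->|]; rewrite ?mulr0 // inE.
Qed.
End CliffGen.

Definition complexify (R : rcfType) p q (P : 'M[R]_(p, q) -> Prop)
    (X : 'M[R[i]]_(p, q)) : Prop :=
  P (map_mx (@complex.Re R) X) /\ P (map_mx (@complex.Im R) X).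

Section Osp.
Variables (R : rcfType) (m n : nat).

Definition sdim : nat := (m + m) + (n * 2 + 1).

Definition parity (i : 'I_sdim) : bool := (m + m <= i)%N.

Definition formB : 'M[R]_sdim :=
  block_mx (block_mx 0 1%:M (- 1%:M) 0) 0 0 1%:M.

Definition bform (v w : 'cV[R]_sdim) : R := (v^T *m formB *m w) 0 0.

Definition vec_homog (e : bool) (v : 'cV[R]_sdim) : Prop :=
  forall i, parity i != e -> v i 0 = 0.

Definition mx_homog (d : bool) (X : 'M[R]_sdim) : Prop :=
  forall i j, parity i (+) parity j != d -> X i j = 0.

Definition osp_homog (d : bool) (X : 'M[R]_sdim) : Prop :=
  mx_homog d X /\
  forall (e : bool) (v w : 'cV[R]_sdim), vec_homog e v ->
    bform (X *m v) w + (-1) ^+ (d && e) * bform v (X *m w) = 0.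

Definition osp (X : 'M[R]_sdim) : Prop :=
  exists X0 X1, [/\ osp_homog false X0, osp_homog true X1 & X = X0 + X1].

(* The Cartan element with parameters h = (a, b). As mxvec_index t e is the   *)
(* index 2t + e, the n blocks b_t u sit on consecutive pairs of coordinates.  *)
Definition cartan_mx (h : 'rV[R]_m * 'rV[R]_n) : 'M[R]_sdim :=
  block_mx
    (block_mx 0 (diag_mx h.1) (- diag_mx h.1) 0) 0
    0
    (block_mx
       (\sum_(t < n) h.2 0 t *:
          (delta_mx (mxvec_index t (0 : 'I_2)) (mxvec_index t (1 : 'I_2))
           - delta_mx (mxvec_index t (1 : 'I_2)) (mxvec_index t (0 : 'I_2)))) 0
       0 0).

Definition weight := 'rV[R]_m * 'rV[R]_n -> R[i].
Definition wt_e (s : 'I_m) : weight := fun h => 'i%C * (h.1 0 s)%:C%C.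
Definition wt_f (t : 'I_n) : weight := fun h => 'i%C * (h.2 0 t)%:C%C.

Inductive pos_root : weight -> Prop :=
| PosEminusE (i j : 'I_m) : (i < j)%N -> pos_root (wt_e i \- wt_e j)
| PosEplusE (i j : 'I_m) : (i <= j)%N -> pos_root (wt_e i \+ wt_e j)
| PosFminusF (i j : 'I_n) : (i < j)%N -> pos_root (wt_f i \- wt_f j)
| PosFplusF (i j : 'I_n) : (i < j)%N -> pos_root (wt_f i \+ wt_f j)
| PosF (j : 'I_n) : pos_root (wt_f j)
| PosEplusF (i : 'I_m) (j : 'I_n) : pos_root (wt_e i \+ wt_f j)
| PosEminusF (i : 'I_m) (j : 'I_n) : pos_root (wt_e i \- wt_f j)
| PosE (i : 'I_m) : pos_root (wt_e i).

Definition neg_root (alpha : weight) : Prop :=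
  exists2 beta, pos_root beta & alpha =1 \- beta.

(* The Cartan subalgebra is even, so its superbracket is the commutator.      *)
Definition root_vector (alpha : weight) (X : 'M[R[i]]_sdim) : Prop :=
  [/\ complexify osp X, X != 0 &
   forall h, let H := map_mx (real_complex R) (cartan_mx h) in
     H *m X - X *m H = alpha h *: X].

Definition gen : finType := ('I_m + 'I_m + ('I_n + 'I_n + unit))%type.
Definition gen_p (s : 'I_m) : gen := inl (inl s).
Definition gen_q (s : 'I_m) : gen := inl (inr s).
Definition gen_r (t : 'I_n) : gen := inr (inl (inl t)).
Definition gen_s (t : 'I_n) : gen := inr (inl (inr t)).
Definition gen_c : gen := inr (inr tt).

Definition gen_odd (x : gen) : bool := if x is inr _ then true else false.

Definition gen_coord (x : gen) : 'I_sdim :=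
  match x with
  | inl (inl s) => lshift _ (lshift m s)
  | inl (inr s) => lshift _ (rshift m s)
  | inr (inl (inl t)) => rshift _ (lshift 1 (mxvec_index t (0 : 'I_2)))
  | inr (inl (inr t)) => rshift _ (lshift 1 (mxvec_index t (1 : 'I_2)))
  | inr (inr _) => rshift _ (rshift (n * 2) 0)
  end.

Definition gen_vec (x : gen) : 'cV[R]_sdim :=
  (if gen_odd x then Num.sqrt 2 else 1) *: delta_mx (gen_coord x) 0.

Definition scomm (A : pzRingType) (d e : bool) (x y : A) : A :=
  x * y - (-1) ^+ (d && e) * (y * x).

(* The matrix of ad m(x, y) on V, that is, of                                 *)
(* v |-> 2 (b(y, v) x + (-1)^(deg x deg y) b(x, v) y); see ad_mP.             *)
Definition ad_m (x y : gen) : 'M[R]_sdim :=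
  2 *: (gen_vec x *m (gen_vec y)^T *m formB
        + (-1) ^+ (gen_odd x && gen_odd y) *:
            (gen_vec y *m (gen_vec x)^T *m formB)).

End Osp.
Section OspLemmas.
Variables (R : rcfType) (m n : nat).
Local Notation D := (sdim m n).
Local Notation gen := (gen m n).
Local Notation B := (formB R m n).

Definition coord_gen (i : 'I_D) : gen :=
  match split i with
  | inl i' => match split i' with inl s => gen_p n s | inr s => gen_q n s end
  | inr i' => match split i' with
     | inl k => let p := enum_val (cast_ord (esym (mxvec_cast n 2)) k) in
        if p.2 == 0 then gen_r m p.1 else gen_s m p.1
     | inr _ => gen_c m n end
  end.

Lemma coord_genK : cancel coord_gen (@gen_coord m n).
Proof.
move=> i; rewrite /coord_gen; case: (split_ordP i) => i' ->.
  by case: (split_ordP i') => s ->.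
case: (split_ordP i') => k ->; last by rewrite /= (ord1 k).
case/mxvec_indexP: k => t e; rewrite /mxvec_index cast_ordK enum_rankK /=.
case: eqP => [->|ne] //=; congr (rshift _ (lshift _ (mxvec_index t _))).
by apply/val_inj; case: e ne => [[|[|]]] //= ? [] ; apply/val_inj.
Qed.

Lemma gen_coordK : cancel (@gen_coord m n) coord_gen.
Proof.
move=> [[s|s]|[[t|t]|[]]]; rewrite /coord_gen.
- by rewrite !(unsplitK (inl _)).
- by rewrite (unsplitK (inl _)) (unsplitK (inr _)).
- by rewrite (unsplitK (inr _)) (unsplitK (inl _)) cast_ordK enum_rankK.
- by rewrite (unsplitK (inr _)) (unsplitK (inl _)) cast_ordK enum_rankK.
- by rewrite !(unsplitK (inr _)).
Qed.

Lemma gen_coord_bij : bijective (@gen_coord m n).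
Proof. by exists coord_gen; [exact: gen_coordK|exact: coord_genK]. Qed.

Lemma parity_l (i : 'I_(m + m)) : @parity m n (lshift _ i) = false.
Proof. by apply/negbTE; rewrite /parity -ltnNge (ltn_ord i). Qed.

Lemma parity_r (i : 'I_(n * 2 + 1)) : @parity m n (rshift _ i) = true.
Proof. exact: leq_addr. Qed.

Lemma parity_coord (x : gen) : parity (gen_coord x) = gen_odd x.
Proof. by case: x => [[s|s]|[[t|t]|u]]; rewrite (parity_l, parity_r). Qed.

Lemma formB_par (i j : 'I_D) : parity i != parity j -> B i j = 0.
Proof.
case: (split_ordP i) => i' ->; case: (split_ordP j) => j' ->.
- by rewrite !parity_l.
- by rewrite block_mxEur mxE.
- by rewrite block_mxEdl mxE.
- by rewrite !parity_r.
Qed.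

Lemma formB_tr (i j : 'I_D) : B j i = - (-1) ^+ parity i * B i j.
Proof.
case: (split_ordP i) => i' ->; case: (split_ordP j) => j' ->.
- rewrite parity_l expr0 mulN1r !block_mxEul.
  case: (split_ordP i') => s ->; case: (split_ordP j') => t ->.
  + by rewrite !block_mxEul !mxE oppr0.
  + by rewrite block_mxEur block_mxEdl !mxE eq_sym.
  + by rewrite block_mxEur block_mxEdl !mxE eq_sym opprK.
  + by rewrite !block_mxEdr !mxE oppr0.
- by rewrite block_mxEur block_mxEdl !mxE mulr0.
- by rewrite block_mxEur block_mxEdl !mxE mulr0.
- by rewrite parity_r expr1 opprK mul1r !block_mxEdr !mxE eq_sym.
Qed.

Lemma formB_trmx_mul : B^T *m B = 1%:M.
Proof.
rewrite /formB tr_block_mx tr_block_mx !trmx0 mulmx_block.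
rewrite mulmx_block !(mulmx0, mul0mx, addr0, add0r).
rewrite mulmxN !trmx1 !mulmx1 raddfN /= trmx1 opprK.
by rewrite -!scalar_mx_block.
Qed.

Lemma formB_mul_trmx : B *m B^T = 1%:M.
Proof. exact/mulmx1C/formB_trmx_mul. Qed.

Definition gscale (x : gen) : R := if gen_odd x then Num.sqrt 2 else 1.

Lemma gscale_neq0 x : gscale x != 0.
Proof.
by rewrite /gscale; case: gen_odd; rewrite ?oner_neq0 // sqrtr_eq0 -ltNge ltr0n.
Qed.

Lemma vec_homog_gen x : vec_homog (m:=m) (n:=n) (gen_odd x) (gen_vec R x).
Proof.
move=> i; rewrite -parity_coord !mxE eqxx andbT => ne.
by case: (i =P gen_coord x) ne => [->|_ _]; rewrite ?eqxx // mulr0.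
Qed.

Lemma vec_homog_delta (i : 'I_D) :
  vec_homog (m:=m) (n:=n) (parity i) (delta_mx i 0 : 'cV[R]_D).
Proof.
move=> k; rewrite !mxE eqxx andbT => ne.
by case: (k =P i) ne => [->|]; rewrite ?eqxx.
Qed.

Lemma bformE (v w : 'cV[R]_D) :
  bform v w = \sum_i \sum_j v i 0 * B i j * w j 0.
Proof.
rewrite /bform mxE exchange_big; apply: eq_bigr => j _ /=.
by rewrite mxE mulr_suml; apply: eq_bigr => i _; rewrite mxE.
Qed.

Lemma bform_homog d e (v w : 'cV[R]_D) :
  vec_homog (m:=m) (n:=n) d v -> vec_homog (m:=m) (n:=n) e w -> d != e -> bform v w = 0.
Proof.
move=> hv hw de; rewrite bformE big1 // => i _; rewrite big1 // => j _.
have [pi|/hv ->] := eqVneq (parity i) d; last by rewrite !mul0r.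
have [pj|/hw ->] := eqVneq (parity j) e; last by rewrite mulr0.
by rewrite formB_par ?mulr0 ?mul0r // pi pj.
Qed.

Lemma bform_sym d (v w : 'cV[R]_D) :
  vec_homog (m:=m) (n:=n) d v -> bform w v = - (-1) ^+ d * bform v w.
Proof.
move=> hv; rewrite !bformE exchange_big mulr_sumr; apply: eq_bigr => i _.
rewrite mulr_sumr; apply: eq_bigr => j _.
have [<-|/hv ->] := eqVneq (parity i) d; last by rewrite !mul0r !mulr0.
by rewrite formB_tr; ring.
Qed.

Lemma bformDl (u v w : 'cV[R]_D) : bform (u + v) w = bform u w + bform v w.
Proof. by rewrite /bform linearD /= !mulmxDl mxE. Qed.
Lemma bformDr (u v w : 'cV[R]_D) : bform w (u + v) = bform w u + bform w v.
Proof. by rewrite /bform mulmxDr mxE. Qed.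
Lemma bformZl a (v w : 'cV[R]_D) : bform (a *: v) w = a * bform v w.
Proof. by rewrite /bform linearZ /= -!scalemxAl mxE. Qed.
Lemma bformZr a (v w : 'cV[R]_D) : bform w (a *: v) = a * bform w v.
Proof. by rewrite /bform -!scalemxAr mxE. Qed.

Lemma ad_m_mul x y (v : 'cV[R]_D) :
  ad_m R x y *m v =
  2 *: (bform (gen_vec R y) v *: gen_vec R x
    + ((-1) ^+ (gen_odd x && gen_odd y) * bform (gen_vec R x) v)
       *: gen_vec R y).
Proof.
have E (u w : 'cV[R]_D) : u *m w^T *m B *m v = bform w v *: u.
  rewrite -!mulmxA [w^T *m _]mx11_scalar mul_mx_scalar /bform.
  by rewrite -mulmxA.
rewrite /ad_m -(scalemxAl 2) mulmxDl -(scalemxAl ((-1) ^+ _)) !E.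
by rewrite (scalerA ((-1) ^+ _)).
Qed.

End OspLemmas.

Section OspSpan.
Variables (R : rcfType) (m n : nat).
Local Notation D := (sdim m n).
Local Notation gen := (gen m n).
Local Notation B := (formB R m n).

Lemma scomm_leibniz (A : pzRingType) d e f (x y v : A) :
  scomm (d (+) e) f (x * y) v =
  x * scomm e f y v + (-1) ^+ (e && f) * (scomm d f x v * y).
Proof.
rewrite /scomm.
have -> : (-1) ^+ ((d (+) e) && f) = (-1) ^+ (e && f) * (-1) ^+ (d && f) :> A.
  by rewrite -signr_addb; case: d e f => [] [] [].
move: (e && f) (d && f) => a b; rewrite !mulrBr !mulrBl !mulrA.
have C (c : bool) (u w : A) : u * (-1) ^+ c * w = (-1) ^+ c * u * w.
  by rewrite (commr_sign u c).
by rewrite C mulrBr !mulrA addrA subrK.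
Qed.

(* In every algebra satisfying the Clifford-Weyl relations, the action of     *)
(* m(x, y) by supercommutator on the image of V is given by ad_m.             *)
Lemma ad_mP (A : algType R) (iota : {linear 'cV[R]_D -> A}) :
  (forall x y : gen,
     scomm (gen_odd x) (gen_odd y) (iota (gen_vec R x)) (iota (gen_vec R y))
     = (bform (gen_vec R x) (gen_vec R y))%:A) ->
  forall x y v : gen,
    scomm (gen_odd x (+) gen_odd y) (gen_odd v)
      (iota (gen_vec R x) * iota (gen_vec R y)
       + (-1) ^+ (gen_odd x && gen_odd y)
         * (iota (gen_vec R y) * iota (gen_vec R x)))
      (iota (gen_vec R v))
    = iota (ad_m R x y *m gen_vec R v).
Proof.
move=> rel x y v; rewrite ad_m_mul.
have scommD d e (a b w : A) : scomm d e (a + b) w = scomm d e a w + scomm d e b w.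
  by rewrite /scomm mulrDl !mulrDr opprD addrACA.
have scommZ d e (s : bool) (a w : A) :
    scomm d e ((-1) ^+ s * a) w = (-1) ^+ s * scomm d e a w.
  by rewrite /scomm; case: s; rewrite ?mul1r // !mulN1r mulNr !mulrN opprD !opprK.
have L := scomm_leibniz (gen_odd y) (gen_odd x) (gen_odd v)
  (iota (gen_vec R y)) (iota (gen_vec R x)) (iota (gen_vec R v)).
rewrite addbC in L; rewrite scommD scommZ L scomm_leibniz !rel.
have h (u w : gen) : gen_odd u != gen_odd w -> bform (gen_vec R u) (gen_vec R w) = 0.
  by apply: bform_homog; apply: vec_homog_gen.
move: (h x v) (h y v); move: (bform _ _) (bform _ _) => bx by'.
move: (gen_vec R x) (gen_vec R y) (gen_odd x) (gen_odd y) (gen_odd v).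
move=> gx gy p q r hx hy; rewrite !mulr_algr !mulr_algl.
have sgZ (s : bool) (a : A) : (-1) ^+ s * a = ((-1) ^+ s : R) *: a.
  by case: s; rewrite ?mul1r ?scale1r // mulN1r scaleN1r.
rewrite [RHS]linearZ [iota (_ + _)]linearD ![iota (_ *: _)]linearZ /= !sgZ.
rewrite (scalerDr ((-1) ^+ (p && q))) !scalerA.
have -> : (-1) ^+ (p && q) * (-1) ^+ (p && r) * bx = bx.
  have [->|/hy->] := eqVneq q r; last by rewrite !mulr0.
  by rewrite -signr_addb addbb mul1r.
have -> : (-1) ^+ (q && r) * by' = (-1) ^+ (p && q) * by'.
  by have [->|/hx->] := eqVneq p r; rewrite ?mulr0 // andbC.
by rewrite [X in _ + X]addrC -mulr2n scaler_nat.
Qed.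

Lemma osp_homog_ad_m x y : osp_homog (m:=m) (n:=n) (gen_odd x (+) gen_odd y) (ad_m R x y).
Proof.
split.
  move=> i j pij.
  have Z u w : gen_odd u (+) gen_odd w = gen_odd x (+) gen_odd y ->
      (gen_vec R u *m (gen_vec R w)^T *m B) i j = 0.
    move=> uw; rewrite mxE big1 // => k _; rewrite mxE big_ord1 [_^T _ _]mxE.
    have [kj|kj] := eqVneq (parity k) (parity j); last first.
      by rewrite formB_par // mulr0.
    have [iu|/vec_homog_gen->] := eqVneq (parity i) (gen_odd u); last first.
      by rewrite !mul0r.
    have [kw|/vec_homog_gen->] := eqVneq (parity k) (gen_odd w); last first.
      by rewrite mulr0 mul0r.
    by move: pij; rewrite -uw -iu -kw kj eqxx.
  rewrite [LHS]mxE [X in _ * X]mxE [X in _ + X]mxE !Z //; last by rewrite addbC.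
  by rewrite mulr0 addr0 mulr0.
move=> e v w hv; rewrite !ad_m_mul.
have El (gx gy : 'cV[R]_D) a b :
    bform (2 *: (a *: gx + b *: gy)) w = 2 * (a * bform gx w + b * bform gy w).
  by rewrite bformZl bformDl !bformZl.
have Er (gx gy : 'cV[R]_D) a b :
    bform v (2 *: (a *: gx + b *: gy)) = 2 * (a * bform v gx + b * bform v gy).
  by rewrite bformZr bformDr !bformZr.
rewrite El Er.
have hx := @vec_homog_gen R m n x; have hy := @vec_homog_gen R m n y.
rewrite (bform_sym v hx) (bform_sym v hy).
move: (bform_homog hx hv) (bform_homog hy hv).
move: (bform (gen_vec R x) v) (bform (gen_vec R y) v) => bx by'.
move: (bform _ w) (bform _ w) => cx cy; move: (gen_odd x) (gen_odd y).
move=> p q h1 h2.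
clear hv hx hy.
case: p q e h1 h2 => [] [] [] h1 h2; rewrite ?(h1 isT) ?(h2 isT) /= ?expr1 ?expr0;
  ring.
Qed.

Lemma osp_homog0 d : osp_homog (m:=m) (n:=n) d (0 : 'M[R]_D).
Proof.
split=> [i j|e v w] _; first by rewrite mxE.
rewrite !mul0mx /bform linear0 !mul0mx mulmx0.
by rewrite !mxE mulr0 addr0.
Qed.

Lemma osp_ad_m x y : osp (m:=m) (n:=n) (ad_m R x y).
Proof.
have := osp_homog_ad_m x y; case: (_ (+) _) => h.
  by exists 0, (ad_m R x y); split; rewrite ?add0r //; apply: osp_homog0.
by exists (ad_m R x y), 0; split; rewrite ?addr0 //; apply: osp_homog0.
Qed.

Lemma ad_m_expand (c : gen -> gen -> R) (W := \matrix_(i, j)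
     (gscale R (coord_gen i) * gscale R (coord_gen j)
      * c (coord_gen i) (coord_gen j)) : 'M[R]_D) :
  \sum_x \sum_y c x y *: ad_m R x y
  = 2 *: ((W + \matrix_(i, j) ((-1) ^+ (parity i && parity j) * W j i)) *m B).
Proof.
have E (x y : gen) : gen_vec R x *m (gen_vec R y)^T =
    (gscale R x * gscale R y) *: delta_mx (gen_coord x) (gen_coord y).
  rewrite /gen_vec -/(gscale R x) -/(gscale R y) [(_ *: _)^T]linearZ /=.
  by rewrite -scalemxAr -scalemxAl scalerA trmx_delta mul_delta_mx mulrC.
transitivity (2 *: ((\sum_x \sum_y c x y *: (gen_vec R x *m (gen_vec R y)^T
   + (-1) ^+ (gen_odd x && gen_odd y) *: (gen_vec R y *m (gen_vec R x)^T))) *m B)).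
  rewrite mulmx_suml scaler_sumr; apply: eq_bigr => x _.
  rewrite mulmx_suml scaler_sumr; apply: eq_bigr => y _.
  rewrite -(scalemxAl (c x y)) mulmxDl -(scalemxAl ((-1) ^+ _)) /ad_m.
  by rewrite scalerA [in RHS]scalerA [2 * _]mulrC.
congr (_ *: (_ *m _)).
rewrite (reindex (@coord_gen m n)) /=; last first.
  by apply: onW_bij; exists (@gen_coord m n); [exact: coord_genK|exact: gen_coordK].
under eq_bigr => i _.
  rewrite (reindex (@coord_gen m n)) /=; last first.
    by apply: onW_bij; exists (@gen_coord m n); [exact: coord_genK|exact: gen_coordK].
  under eq_bigr => j _ do rewrite !E !coord_genK scalerDr !scalerA
    -!parity_coord !coord_genK.
  rewrite big_split /=; over.
rewrite big_split /=; congr (_ + _).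
  rewrite [RHS]matrix_sum_delta; apply: eq_bigr => i _; apply: eq_bigr => j _.
  by rewrite !mxE mulrC.
rewrite exchange_big /= [RHS]matrix_sum_delta.
apply: eq_bigr => i _; apply: eq_bigr => j _; rewrite !mxE.
by rewrite andbC; congr (_ *: _); ring.
Qed.

Lemma osp_homog_span d X : osp_homog (m:=m) (n:=n) d X ->
  exists c : gen -> gen -> R, X = \sum_x \sum_y c x y *: ad_m R x y.
Proof.
move=> [hX inv]; pose W := X *m B^T.
have XW : X = W *m B by rewrite /W -mulmxA formB_trmx_mul mulmx1.
have hW i j : parity i (+) parity j != d -> W i j = 0.
  move=> pij; rewrite mxE big1 // => k _; rewrite [_^T _ _]mxE.
  have [kj|kj] := eqVneq (parity j) (parity k); last first.
    by rewrite formB_par // mulr0.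
  by rewrite hX ?mul0r // -kj.
clearbody W; have invE i j : (X^T *m B) i j + (-1) ^+ (d && parity i) * (B *m X) i j = 0.
  have := inv _ _ (delta_mx j 0) (@vec_homog_delta R m n i).
  have -> : bform (X *m delta_mx i 0) (delta_mx j 0) = (X^T *m B) i j.
    rewrite /bform -colE mxE trmx_mul trmx_delta -mulmxA -rowE.
    exact: mxE.
  have -> : bform (delta_mx i 0) (X *m delta_mx j 0) = (B *m X) i j.
    rewrite /bform trmx_delta -mulmxA (mulmxA B) -rowE -colE [LHS]mxE.
    exact: mxE.
  by [].
pose Z := \matrix_(k, j) ((-1) ^+ parity k * W j k
   - (-1) ^+ (d && parity k) * W k j).
have BZ : B *m Z = 0.
  pose N := \matrix_(i, l) ((-1) ^+ (d && parity i) * (B *m W) i l).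
  have ZE : B *m Z = - (X^T + N).
    apply/matrixP=> i l; rewrite XW trmx_mul [LHS]mxE [RHS]mxE [X in - X]mxE.
    rewrite [N i l]mxE [(B *m W) _ _]mxE [(_^T *m _) _ _]mxE mulr_sumr -big_split.
    rewrite -sumrN; apply: eq_bigr => k _ /=.
    rewrite ![_^T _ _]mxE (formB_tr R i k) [Z _ _]mxE.
    have [->|ki] := eqVneq (parity i) (parity k); first by ring.
    by rewrite formB_par //; ring.
  have S0 : (X^T + N) *m B = 0.
    apply/matrixP=> i j; rewrite mulmxDl [LHS]mxE [RHS]mxE -(invE i j).
    congr (_ + _); rewrite [in RHS]XW mulmxA [LHS]mxE [X in _ = _ * X]mxE mulr_sumr.
    by apply: eq_bigr => l _; rewrite [N _ _]mxE mulrA.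
  rewrite ZE; suff -> : X^T + N = 0 by rewrite oppr0.
  by rewrite -[LHS]mulmx1 -formB_mul_trmx mulmxA S0 mul0mx.
have Z0 : Z = 0 by rewrite -[Z]mul1mx -formB_trmx_mul -mulmxA BZ mulmx0.
have Wsym j k : W j k = (-1) ^+ (parity j && parity k) * W k j.
  have /matrixP/(_ k j) := Z0; rewrite !mxE => /eqP; rewrite subr_eq0 => /eqP.
  have [pd|pd] := eqVneq (parity k (+) parity j) d; last first.
    by move=> _; rewrite (hW k j pd) (hW j k) ?mulr0 // addbC.
  rewrite -pd; case: (parity k) (parity j) => [] [] /=;
    rewrite ?expr1 ?expr0 ?mul1r ?mulN1r //.
  - by move=> <-; rewrite opprK.
  - by move/oppr_inj.
exists (fun x y => W (gen_coord x) (gen_coord y) / (4 * gscale R x * gscale R y)).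
rewrite ad_m_expand {1}XW scalemxAl; congr (_ *m _).
apply/matrixP=> i j; rewrite !mxE !coord_genK (Wsym j i) andbC.
have := signr_addb R (parity j && parity i) (parity j && parity i).
rewrite addbb; move: ((-1) ^+ (parity j && parity i)) => s ss.
have gi := gscale_neq0 R (coord_gen i); have gj := gscale_neq0 R (coord_gen j).
transitivity (2^-1 * W i j + 2^-1 * (s * s) * W i j).
  by rewrite -ss; field.
by field; rewrite gi gj.
Qed.

Lemma osp_span X : osp (m:=m) (n:=n) X ->
  exists c : gen -> gen -> R, X = \sum_x \sum_y c x y *: ad_m R x y.
Proof.
move=> [X0 [X1 [/osp_homog_span[c0 E0] /osp_homog_span[c1 E1] ->]]].
exists (fun x y => c0 x y + c1 x y); rewrite E0 E1 -big_split.
apply: eq_bigr => x _; rewrite -big_split; apply: eq_bigr => y _.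
by rewrite scalerDl.
Qed.

Lemma ad_m_rel (c : gen -> gen -> R) :
  \sum_x \sum_y c x y *: ad_m R x y = 0 ->
  forall x y, c x y = - (-1) ^+ (gen_odd x && gen_odd y) * c y x.
Proof.
rewrite ad_m_expand; set W := \matrix_(i, j) _; set W' := \matrix_(i, j) _.
move=> /eqP; rewrite scaler_eq0 pnatr_eq0 /= => /eqP WB x y.
have {WB} : W + W' = 0.
  by rewrite -[LHS]mulmx1 -formB_mul_trmx mulmxA WB mul0mx.
move/matrixP/(_ (gen_coord x) (gen_coord y)); rewrite !mxE !gen_coordK !parity_coord.
set s := (-1) ^+ _ => e.
have gg : gscale R x * gscale R y != 0 by rewrite mulf_neq0 ?gscale_neq0.
apply: (mulfI gg); apply/eqP; rewrite -subr_eq0 -[X in _ == X]e; apply/eqP; ring.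
Qed.

Lemma ad_m_relC (c : gen -> gen -> R[i]) :
  \sum_x \sum_y c x y *: map_mx (real_complex R) (ad_m R x y) = 0 ->
  forall x y, c x y = - (-1) ^+ (gen_odd x && gen_odd y) * c y x.
Proof.
move=> e x y.
have part (f : {additive R[i] -> R}) :
    (forall (a : R[i]) (r : R), f (a * r%:C%C) = f a * r) ->
    \sum_x \sum_y f (c x y) *: ad_m R x y = 0.
  move=> fM; apply/matrixP=> i j; have /matrixP/(_ i j)/(congr1 f) := e.
  rewrite ![(0 : 'M_(_, _)) i j]mxE raddf0; apply: etrans.
  rewrite !summxE raddf_sum; apply: eq_bigr => u _.
  rewrite !summxE raddf_sum; apply: eq_bigr => v _.
  by rewrite mxE [(_ *: map_mx _ _) i j]mxE [map_mx _ _ i j]mxE fM.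
have sgC (s : bool) (a : R[i]) (f : {additive R[i] -> R}) :
    f (- (-1) ^+ s * a) = - (-1) ^+ s * f a.
  by case: s; rewrite ?expr1 ?expr0 ?opprK ?mul1r ?mulN1r ?raddfN.
have hRe := ad_m_rel (part (@complex.Re R) _) x y.
have hIm := ad_m_rel (part (@complex.Im R) _) x y.
apply/eqP; rewrite eq_complex !sgC; apply/andP; split; apply/eqP.
  by apply: hRe => -[a b] r /=; rewrite mulr0 subr0.
by apply: hIm => -[a b] r /=; rewrite mulr0 add0r.
Qed.
End OspSpan.

Section Fock.
Variables (R : rcfType) (m n L : nat).

(* F^L = C[z] (x) Cliff(C) is the Clifford algebra over the ring C[z].        *)
Definition zpoly : comNzRingType := {mpoly R[i][m * L]}.
Definition fock := cliff zpoly (n * L + L).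

Definition zvar (s : 'I_m) (k : 'I_L) : zpoly := 'X_(mxvec_index s k).
Definition rgen (t : 'I_n) (k : 'I_L) : fock :=
  cliff_gen zpoly (lshift L (mxvec_index t k)).
Definition cgen (k : 'I_L) : fock := cliff_gen zpoly (rshift (n * L) k).

Definition cscale (a : R[i]) (f : fock) : fock := (a%:MP : zpoly) *: f.

Definition zmult (s : 'I_m) (k : 'I_L) (f : fock) : fock := zvar s k *: f.
Definition zderiv (s : 'I_m) (k : 'I_L) (f : fock) : fock :=
  [ffun S : {set 'I_(n * L + L)} =>
     mderiv (mxvec_index s k) (f S : {mpoly R[i][m * L]})].

Section Rep.
Variable zeta : R[i].

Definition op_p s k (f : fock) : fock :=
  cscale ('i%C * zeta / (Num.sqrt 2)%:C%C) (zmult s k f - zderiv s k f).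
Definition op_q s k (f : fock) : fock :=
  cscale (zeta / (Num.sqrt 2)%:C%C) (zmult s k f + zderiv s k f).
Definition op_r t k (f : fock) : fock := rgen t k * f.
Definition op_s t k (f : fock) : fock :=
  cscale 'i%C (rgen t k * cliff_flip (lshift L (mxvec_index t k)) f).
Definition op_c k (f : fock) : fock := cgen k * f.

Definition op (x : gen m n) (k : 'I_L) : fock -> fock :=
  match x with
  | inl (inl s) => op_p s k
  | inl (inr s) => op_q s k
  | inr (inl (inl t)) => op_r t k
  | inr (inl (inr t)) => op_s t k
  | inr (inr _) => op_c k
  end.

Definition rho_m (x y : gen m n) (f : fock) : fock :=
  \sum_(k < L) (op x k (op y k f)
    + (-1) ^+ (gen_odd x && gen_odd y) *: op y k (op x k f)).

(* The linear extension X |-> rho(X) of m(x, y) |-> rho_m x y to the          *)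
(* complexification: X is decomposed along the spanning family of the ad_m,   *)
(* which spans by osp_span; the coordinates are immaterial by osp_repE.       *)
Definition ad_m_rows :
    'M[R[i]]_(#|{: gen m n * gen m n}|, sdim m n * sdim m n) :=
  \matrix_k mxvec (map_mx (real_complex R)
    (ad_m R (enum_val k).1 (enum_val k).2)).

Definition osp_coef (X : 'M[R[i]]_(sdim m n)) (x y : gen m n) : R[i] :=
  (mxvec X *m pinvmx ad_m_rows) 0 (enum_rank (x, y)).

Definition osp_rep (X : 'M[R[i]]_(sdim m n)) (f : fock) : fock :=
  \sum_(x : gen m n) \sum_(y : gen m n) cscale (osp_coef X x y) (rho_m x y f).

Lemma cscaleDl a b f : cscale (a + b) f = cscale a f + cscale b f.
Proof. by rewrite /cscale mpolyCD scalerDl. Qed.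
Lemma cscaleDr a f g : cscale a (f + g) = cscale a f + cscale a g.
Proof. exact: scalerDr. Qed.
Lemma cscaleM a b f : cscale a (cscale b f) = cscale (a * b) f.
Proof. by rewrite /cscale scalerA mpolyCM. Qed.
Lemma cscale0 f : cscale 0 f = 0.
Proof. by rewrite /cscale mpolyC0 scale0r. Qed.
Lemma cscale1 f : cscale 1 f = f.
Proof. by rewrite /cscale mpolyC1 scale1r. Qed.
Lemma cscaleNl a f : cscale (- a) f = - cscale a f.
Proof. by rewrite /cscale mpolyCN scaleNr. Qed.
Lemma cscaleNr a f : cscale a (- f) = - cscale a f.
Proof. exact: scalerN. Qed.

Lemma rho_mC x y f :
  rho_m y x f = (-1) ^+ (gen_odd x && gen_odd y) *: rho_m x y f.
Proof.
rewrite /rho_m scaler_sumr; apply: eq_bigr => k _.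
by rewrite scalerDr scalerA -signr_addb addbb scale1r andbC addrC.
Qed.

Lemma osp_coefK (c : gen m n -> gen m n -> R[i]) :
  let X := \sum_x \sum_y c x y *: map_mx (real_complex R) (ad_m R x y) in
  \sum_x \sum_y osp_coef X x y *: map_mx (real_complex R) (ad_m R x y) = X.
Proof.
move=> X.
have E (u : 'rV[R[i]]_#|{: gen m n * gen m n}|) :
    \sum_x \sum_y u 0 (enum_rank (x, y)) *: map_mx (real_complex R) (ad_m R x y)
    = vec_mx (u *m ad_m_rows).
  rewrite mulmx_sum_row linear_sum /= pair_big /=.
  rewrite [RHS](reindex enum_rank) /=; last exact/onW_bij/enum_rank_bij.
  apply: eq_bigr => -[x y] _; rewrite linearZ /= rowK mxvecK enum_rankK //.
rewrite E mulmxKpV ?mxvecK //.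
pose u := \row_k c (enum_val k).1 (enum_val k).2 :
  'rV[R[i]]_#|{: gen m n * gen m n}|.
apply/submxP; exists u; rewrite -[RHS]vec_mxK -E; congr (mxvec _).
apply: eq_bigr => x _; apply: eq_bigr => y _.
by rewrite mxE enum_rankK.
Qed.

Lemma osp_repE (c : gen m n -> gen m n -> R[i]) (f : fock) :
  osp_rep
    (\sum_x \sum_y c x y *: map_mx (real_complex R) (ad_m R x y)) f
  = \sum_x \sum_y cscale (c x y) (rho_m x y f).
Proof.
have := osp_coefK c; rewrite /osp_rep.
move: (osp_coef _) => c' /= e.
pose d x y := c' x y - c x y.
have drel : forall x y, d x y = - (-1) ^+ (gen_odd x && gen_odd y) * d y x.
  apply: ad_m_relC; apply/eqP; rewrite -subr_eq0 subr0; apply/eqP.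
  transitivity (\sum_x \sum_y c' x y *: map_mx (real_complex R) (ad_m R x y) -
     \sum_x \sum_y c x y *: map_mx (real_complex R) (ad_m R x y)).
    rewrite -sumrB; apply: eq_bigr => x _; rewrite -sumrB; apply: eq_bigr => y _.
    exact: scalerBl.
  by rewrite e subrr.
pose S := \sum_x \sum_y cscale (d x y) (rho_m x y f).
have SN : S = - S.
  rewrite {1}/S exchange_big /S -sumrN; apply: eq_bigr => x _.
  rewrite -sumrN; apply: eq_bigr => y _.
  rewrite drel rho_mC andbC; case: (_ && _).
    by rewrite expr1 opprK mul1r scaleN1r cscaleNr.
  by rewrite expr0 mulN1r scale1r cscaleNl.
have S0 : S = 0.
  rewrite -[S]cscale1 -(mulVf (x := 2 : R[i])) ?pnatr_eq0 // -cscaleM.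
  rewrite [2]mulr2n cscaleDl cscale1 {2}SN subrr; exact: scaler0.
apply/eqP; rewrite -subr_eq0; apply/eqP; rewrite -[RHS]S0 /S -sumrB.
apply: eq_bigr => x _; rewrite -sumrB; apply: eq_bigr => y _.
by rewrite cscaleDl cscaleNl.
Qed.

Definition primitive (v : fock) : Prop :=
  v != 0 /\ forall alpha X, neg_root alpha -> root_vector alpha X ->
    osp_rep X v = 0.
End Rep.

(* Total in the indices: out-of-range variables and generators are 0.         *)
Definition zvarn (s k : nat) : zpoly :=
  if (insub s, insub k) is (Some s', Some k') then zvar s' k' else 0.
Definition rgenn (t : 'I_n) (k : nat) : fock :=
  if insub k is Some k' then rgen t k' else 0.
Definition cgenn (k : nat) : fock :=
  if insub k is Some k' then cgen k' else 0.

(* Indices start from 0: Lambda_minor a is Lambda_a, with rows s = m - a + p  *)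
(* and columns z_(s, 2q) + i z_(s, 2q + 1) for p, q < a, and similarly the    *)
(* pairs in Rfactor and Cfactor are (2k, 2k + 1).                             *)
Definition Lambda_minor (a : nat) : zpoly :=
  \det (\matrix_(p < a, q < a)
    (zvarn (m - a + p) q.*2 + ('i%C)%:MP * zvarn (m - a + p) q.*2.+1)).

Definition Rfactor (b : 'I_n) (j : nat) : fock :=
  (\prod_(0 <= k < j) (rgenn b k.*2 + cscale 'i%C (rgenn b k.*2.+1)))
  * \prod_(j.*2 <= k < L) rgenn b k.

Definition Cfactor : fock :=
  \prod_(0 <= k < L./2) (cgenn k.*2 + cscale 'i%C (cgenn k.*2.+1)).

Definition Lambda (i : 'I_m -> nat) : zpoly :=
  \prod_(a < m) Lambda_minor a.+1 ^+ i a.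

Definition Rvector (j : 'I_n -> nat) : fock :=
  (\prod_(b < n) Rfactor b (j b)) * Cfactor.
End Fock.

(* Main.v *)
Require Import Defs.
From HB Require Import structures.
From mathcomp Require Import all_boot all_order all_algebra.
From mathcomp Require Import complex mpoly ring zify.
From mathcomp Require Import reals.
Import GRing.Theory Num.Theory.
Set Implicit Arguments.
Unset Strict Implicit.
Unset Printing Implicit Defensive.
Local Open Scope ring_scope.

(* Let u, w run over the weight vectors p - iq, p + iq, r - is, r + is, c of  *)
(* V. A root vector X is a combination of the m(u, w) whose weight is that of *)
(* X. At the Cartan element where e_1 > ... > e_m > f_1 > ... > f_n > 0 take  *)
(* consecutive integer values, all negative roots are negative; so it is      *)
(* enough that m(u, w) kills v whenever wt u + wt w is negative there.        *)
(* For x in V let x_k be the k-th copy and x_(q) = x_(2q) + i x_(2q + 1). If  *)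
(* x and y supercommute, x_(2q) y_(2q) + x_(2q + 1) y_(2q + 1) kills v as     *)
(* soon as x_(q) and y_(q) do. The vector v is killed by x_(q) for x = p - iq *)
(* (as Lambda is a function of z_(s, 2q) + i z_(s, 2q + 1)), for x = r - is   *)
(* and r + is in the b-th block and q < j_b, and for x = c; for the remaining *)
(* k one of x_k, y_k kills v. The only pair which is not of this kind,        *)
(* u = p_s - i q_s and w = p_s' + i q_s' with s < s', acts as the             *)
(* polarization replacing row s by row s' in the determinants Lambda_a, hence *)
(* by 0.                                                                      *)

(** * The Clifford algebra *)

(** Since B^T is inverse to B, X B^T is the tensor in V ⊗ V of an element X of osp, and rho(X) is
    the sum over pairs (u, w) of weight vectors of a coordinate of this tensor times the
    superbracket of the ladder operators of u and w ([osp_rep_tensor], [sum_rho_m]). For a negative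
    root vector every term kills v: if the total height of (u, w) is non-negative, the coordinate is
    0 for weight reasons ([neg_root_wcoord]); otherwise the superbracket kills v
    ([superbr_negative]).

    Apart from the polarization case [superbr_pq] and the trivial cancellation [superbr_self], the
    second fact rests on [superbr_kill], which cuts the copies k at a bound 2c. Below it the copies
    cancel in consecutive pairs, both operators being 0 on v along the isotropic direction (1, i);
    from it on, one of the two operators kills v copy by copy. The hypotheses provide such a bound.
    For p - iq against block b, c = j_b works because no minor larger than j_1 <= j_b occurs in
    Lambda. For r - is in block b against r + is in a later block b', c = j_b works because j_b <=
    j_b'.

    As to v being non-zero: C[z] is a domain in which every minor that occurs takes the value 1
    somewhere ([Lambda_minor_neq0]), and each left factor of R maps the non-zero element on its
    right to a non-zero one ([Rvector_neq0]). *)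

Lemma cliff_flip_is_monoid_morphism (K : comNzRingType) d (g : 'I_d) :
  monoid_morphism (@cliff_flip K d g).
Proof. by split; [exact: cliff_flip1|exact: cliff_flipM]. Qed.

HB.instance Definition _ (K : comNzRingType) d (g : 'I_d) :=
  GRing.isLinear.Build K (cliff K d) (cliff K d) _ (@cliff_flip K d g)
    (@cliff_flip_linear K d g).
HB.instance Definition _ (K : comNzRingType) d (g : 'I_d) :=
  GRing.isMonoidMorphism.Build (cliff K d) (cliff K d) (@cliff_flip K d g)
    (@cliff_flip_is_monoid_morphism K d g).

Section Avoids.
Variables (K : comNzRingType) (d : nat).
Implicit Types (g h : 'I_d) (x y A B : cliff K d) (G : {pred 'I_d}).
Local Notation gen := (@cliff_gen K d).

Lemma cliff_flip_gen_neq g h : g != h -> cliff_flip g (gen h) = gen h.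
Proof. by move=> /negPf gh; rewrite cliff_flip_gen gh scale1r. Qed.

Lemma cliff_flip_gen_eq g : cliff_flip g (gen g) = - gen g.
Proof. by rewrite cliff_flip_gen eqxx scaleN1r. Qed.

Lemma cliff_flipC g h x :
  cliff_flip g (cliff_flip h x) = cliff_flip h (cliff_flip g x).
Proof. by apply/ffunP=> S; rewrite !ffunE mulrCA. Qed.

Lemma cliff_gen_mulI g : injective (fun x => gen g * x).
Proof.
move=> x y /(congr1 (fun z => gen g * z)).
by rewrite !mulrA cliff_gen_sqr !mul1r.
Qed.

(* [s = 0, 1, -1] give the actions of [c], [r - i s] and [r + i s].           *)
Definition cliff_ladder g (s : K) x : cliff K d :=
  gen g * (x + s *: cliff_flip g x).

Lemma cliff_ladderZ g s a x :
  cliff_ladder g s (a *: x) = a *: cliff_ladder g s x.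
Proof.
by rewrite /cliff_ladder linearZ /= scalerA mulrC -scalerA -scalerDr scalerAr.
Qed.

(** Each flip fixes the other generator and the two flips commute, so both orders give the same
    combination of flips of x, multiplied by gh in one order and by hg in the other. *)
Lemma cliff_ladder_anticomm g h s t x : g != h ->
  cliff_ladder g s (cliff_ladder h t x) =
  - cliff_ladder h t (cliff_ladder g s x).
Proof.
move=> gh; have hg : h != g by rewrite eq_sym.
have E g' h' s' t' : g' != h' ->
    cliff_ladder g' s' (cliff_ladder h' t' x) = gen g' * gen h' *
     (x + t' *: cliff_flip h' x
      + (s' *: cliff_flip g' x + (s' * t') *: cliff_flip g' (cliff_flip h' x))).
  move=> gh'; rewrite /cliff_ladder cliff_flipM cliff_flip_gen_neq //.
  rewrite linearD linearZ /= scalerAr -mulrDr mulrA scalerDr scalerA.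
  by [].
rewrite !E // (cliff_gen_anticomm K gh) mulNr; congr (- (_ * _)).
by rewrite addrACA (mulrC s t) (cliff_flipC g h).
Qed.

(* [A] lies in the subalgebra generated by the generators outside [G]; the    *)
(* witness [A'] is the image of [A] by the parity automorphism.               *)
Definition avoids G A := (forall g, g \in G -> cliff_flip g A = A) /\
  exists A', forall g, g \in G -> gen g * A = A' * gen g.

Lemma avoids0 G : avoids G 0.
Proof.
split=> [g _|]; first exact: linear0.
by exists 0 => g _; rewrite mulr0 mul0r.
Qed.

Lemma avoids1 G : avoids G 1.
Proof.
split=> [g _|]; first exact: cliff_flip1.
by exists 1 => g _; rewrite mulr1 mul1r.
Qed.

Lemma avoids_gen G h : h \notin G -> avoids G (gen h).
Proof.
move=> hG; have gh g : g \in G -> g != h.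
  by move=> gG; apply: contraNneq hG => <-.
split=> [g /gh /cliff_flip_gen_neq //|]; exists (- gen h) => g /gh gh'.
by rewrite cliff_gen_anticomm // mulNr.
Qed.

Lemma avoidsD G A B : avoids G A -> avoids G B -> avoids G (A + B).
Proof.
move=> [fA [A' AA]] [fB [B' BB]]; split=> [g gG|].
  by rewrite linearD /= fA ?fB.
by exists (A' + B') => g gG; rewrite mulrDr mulrDl AA ?BB.
Qed.

Lemma avoidsZ G a A : avoids G A -> avoids G (a *: A).
Proof.
move=> [fA [A' AA]]; split=> [g gG|]; first by rewrite linearZ /= fA.
by exists (a *: A') => g gG; rewrite -scalerAr AA // scalerAl.
Qed.

Lemma avoidsM G A B : avoids G A -> avoids G B -> avoids G (A * B).
Proof.
move=> [fA [A' AA]] [fB [B' BB]]; split=> [g gG|].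
  by rewrite cliff_flipM fA ?fB.
by exists (A' * B') => g gG; rewrite mulrA AA // -mulrA BB // mulrA.
Qed.

Lemma avoids_prod G I (r : seq I) (P : pred I) (F : I -> cliff K d) :
  (forall i, P i -> avoids G (F i)) -> avoids G (\prod_(i <- r | P i) F i).
Proof. by move=> aF; apply: (big_ind (avoids G)) => //; [exact: avoids1|exact: avoidsM]. Qed.

(** The generator g occurs exactly once in y. Hence 1 + [cliff_flip g] kills y, which is how r - is
    acts by 0 on the unpaired factors of R. *)
Lemma odd_factor g A B (y := A * gen g * B) :
  avoids (pred1 g) A -> avoids (pred1 g) B -> cliff_flip g y = - y.
Proof.
move=> [fA _] [fB _]; rewrite /y !cliff_flipM fA ?inE // fB ?inE //.
by rewrite cliff_flip_gen_eq mulrN mulNr.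
Qed.

Section Imaginary.
Variable j : K.
Hypothesis jj : j * j = -1.

(** The vector g + jh squares to 0. Moved leftwards through A, at the cost of the parity twist A',
    it meets its own copy. The flips turn the factor into -g + jh and g - jh, whose contributions
    cancel as well ([sq2]), so the conclusion holds for every s and covers c, r - is and r + is at
    once. *)
Lemma isotropic_factor g h s A B (y := A * (gen g + j *: gen h) * B) :
  g != h -> avoids (pred2 g h) A -> avoids (pred2 g h) B ->
  cliff_ladder g s y + j *: cliff_ladder h s y = 0.
Proof.
move=> gh [fA [A' AA]] [fB _].
have hg : h != g by rewrite eq_sym.
have gG : g \in pred2 g h by rewrite inE eqxx.
have hG : h \in pred2 g h by rewrite inE eqxx orbT.
have flipg : cliff_flip g y = A * (- gen g + j *: gen h) * B.
  rewrite /y !cliff_flipM fA // fB // linearD linearZ /= cliff_flip_gen_eq.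
  by rewrite cliff_flip_gen_neq.
have fliph : cliff_flip h y = A * (gen g - j *: gen h) * B.
  rewrite /y !cliff_flipM fA // fB // linearD linearZ /= cliff_flip_gen_eq.
  by rewrite cliff_flip_gen_neq // scalerN.
have sq1 : gen g * (gen g + j *: gen h) + j *: (gen h * (gen g + j *: gen h)) = 0.
  rewrite !mulrDr -!scalerAr !cliff_gen_sqr scalerDr scalerA jj scaleN1r.
  by rewrite (cliff_gen_anticomm K gh) addrA scalerN addrNK addrN.
have sq2 : gen g * (- gen g + j *: gen h) + j *: (gen h * (gen g - j *: gen h)) = 0.
  rewrite !mulrDr !mulrN -!scalerAr !cliff_gen_sqr scalerDr scalerN scalerA jj.
  by rewrite scaleN1r opprK (cliff_gen_anticomm K gh) addrA scalerN addrNK addNr.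
have push X Y : gen g * (A * X * B) + j *: (gen h * (A * Y * B)) =
    A' * (gen g * X + j *: (gen h * Y)) * B.
  by rewrite !mulrA !AA // mulrDr mulrDl -scalerAr -scalerAl !mulrA.
rewrite /cliff_ladder flipg fliph /y (mulrDr (gen g)) (mulrDr (gen h)) scalerDr addrACA push.
rewrite sq1 mulr0 mul0r add0r -!scalerAr (scalerA j s) (mulrC j s).
by rewrite -(scalerA s j) -scalerDr push sq2 mulr0 mul0r scaler0.
Qed.
End Imaginary.

Variable half : K.
Hypothesis half2 : half + half = 1.

(* [1 + cliff_flip h] maps [(gen g + a *: gen h) * x] to [2 *: gen g * x].    *)
Lemma cliff_gen_pair_mul_neq0 g h a x : g != h -> cliff_flip h x = x ->
  x != 0 -> (gen g + a *: gen h) * x != 0.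
Proof.
move=> gh fx; apply: contraNneq => gx0.
have : cliff_flip h ((gen g + a *: gen h) * x) = 0 by rewrite gx0 linear0.
rewrite cliff_flipM linearD linearZ /= cliff_flip_gen_eq fx.
rewrite cliff_flip_gen_neq 1?eq_sym // => gx0'.
have gg : gen g * x + gen g * x = 0.
  rewrite -[RHS]addr0 -{1}gx0 -gx0' !mulrDl scalerN mulNr addrACA.
  by rewrite addrN addr0.
apply/eqP/(@cliff_gen_mulI g); rewrite /= mulr0 -[RHS]scale1r -half2 scalerDl.
by rewrite -scalerDr gg scaler0.
Qed.

(** * Products of the Clifford generators along one row *)

Section Line.
Variables (L : nat) (e : 'I_L -> 'I_d).
Hypothesis e_inj : injective e.

(** A common form of [rgenn] and [cgenn], with the same default 0 out of range, so that the factors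
    R_b and C are instances by conversion. *)
Definition line_gen k : cliff K d :=
  if insub k is Some k' then gen (e k') else 0.

Variable j : K.

Definition line_pair k := line_gen k.*2 + j *: line_gen k.*2.+1.

Lemma line_genE (k : 'I_L) : line_gen k = gen (e k).
Proof. by rewrite /line_gen valK. Qed.

Lemma avoids_line_gen G k : (forall k' : 'I_L, k' = k :> nat -> e k' \notin G) ->
  avoids G (line_gen k).
Proof.
move=> eG; rewrite /line_gen; case: insubP => [k' _ /eG|_].
  exact: avoids_gen.
exact: avoids0.
Qed.

Lemma avoids_line_pair G k :
  (forall k' : 'I_L, k' = k.*2 :> nat \/ k' = k.*2.+1 :> nat -> e k' \notin G) ->
  avoids G (line_pair k).
Proof.
by move=> eG; apply: avoidsD; last apply: avoidsZ; apply: avoids_line_gen;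
  move=> k' kk; apply: eG; [left|right].
Qed.

(** Isolates the q-th pair in the shape that [isotropic_factor] expects; injectivity of [e] keeps
    the other pairs off its two generators. *)
Lemma line_pairs_factor (k k' : 'I_L) q b :
  k = q.*2 :> nat -> k' = q.*2.+1 :> nat -> (q < b)%N ->
  exists A B, [/\ avoids (pred2 (e k) (e k')) A, avoids (pred2 (e k) (e k')) B &
    \prod_(0 <= p < b) line_pair p = A * (gen (e k) + j *: gen (e k')) * B].
Proof.
move=> kq kq' qb.
exists (\prod_(0 <= p < q) line_pair p), (\prod_(q.+1 <= p < b) line_pair p).
have av p : p != q -> avoids (pred2 (e k) (e k')) (line_pair p).
  move=> pq; apply: avoids_line_pair => k0 k0p.
  rewrite inE !(inj_eq e_inj) -!val_eqE /= kq kq'; lia.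
split.
- by rewrite big_nat; apply: avoids_prod => p /andP[_ pq]; apply: av; lia.
- by rewrite big_nat; apply: avoids_prod => p /andP[pq _]; apply: av; lia.
- rewrite (big_cat_nat (n := q)) ?(ltnW qb) //= -mulrA; congr (_ * _).
  by rewrite big_ltn // /line_pair -kq' -kq !line_genE.
Qed.

Lemma line_singles_factor (k : 'I_L) q : (q <= k)%N ->
  exists A B, [/\ avoids (pred1 (e k)) A, avoids (pred1 (e k)) B &
    \prod_(q <= p < L) line_gen p = A * gen (e k) * B].
Proof.
move=> qk.
exists (\prod_(q <= p < k) line_gen p), (\prod_(k.+1 <= p < L) line_gen p).
have av (p : nat) : p != k :> nat -> avoids (pred1 (e k)) (line_gen p).
  move=> pq; apply: avoids_line_gen => k0 k0p.
  by rewrite inE !(inj_eq e_inj) -!val_eqE /= k0p.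
split.
- by rewrite big_nat; apply: avoids_prod => p /andP[_ pq]; apply: av; lia.
- by rewrite big_nat; apply: avoids_prod => p /andP[pq _]; apply: av; lia.
- rewrite (big_cat_nat (n := k)) ?(ltnW (ltn_ord k)) //= -mulrA; congr (_ * _).
  by rewrite big_ltn // line_genE.
Qed.

(** When j^2 = -1 each pair is nilpotent, so non-vanishing needs x to be free of the generators
    involved. The rightmost pair is absorbed into x, which stays fixed by the flips of the remaining
    ones. *)
Lemma line_pairs_mul_neq0 b x : (b.*2 <= L)%N ->
  (forall k : 'I_L, (k < b.*2)%N -> cliff_flip (e k) x = x) -> x != 0 ->
  (\prod_(0 <= p < b) line_pair p) * x != 0.
Proof.
elim: b x => [|b IH] x bL fx x0; first by rewrite big_nil mul1r.
rewrite big_nat_recr //= -mulrA; apply: IH; first lia.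
  move=> k kb; rewrite cliff_flipM fx; last lia.
  congr (_ * _); have := @avoids_line_pair (pred1 (e k)) b.
  case=> [k' kk'|fe _]; last by apply: fe; rewrite inE.
  by rewrite inE (inj_eq e_inj) -val_eqE /=; lia.
have k0L : (b.*2 < L)%N by lia.
have k1L : (b.*2.+1 < L)%N by lia.
rewrite /line_pair (line_genE (Ordinal k0L)) (line_genE (Ordinal k1L)).
apply: cliff_gen_pair_mul_neq0 => //; last by apply: fx => /=; lia.
by rewrite (inj_eq e_inj) -val_eqE /=; lia.
Qed.

Lemma line_singles_mul_neq0 q x : x != 0 ->
  (\prod_(q <= p < L) line_gen p) * x != 0.
Proof.
rewrite big_nat.
apply: (big_ind (fun y => forall x, x != 0 -> y * x != 0)) => {x}.
- by move=> x x0; rewrite mul1r.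
- by move=> y z y0 z0 x x0; rewrite -mulrA; apply/y0/z0.
- move=> p /andP[_ pL] x; rewrite (line_genE (Ordinal pL)).
  apply: contraNneq => gx0; apply/eqP/(@cliff_gen_mulI (e (Ordinal pL))).
  by rewrite /= mulr0.
Qed.
End Line.
End Avoids.

(** * Weights *)

Lemma mxvec_index_eq a b (s s' : 'I_a) (t t' : 'I_b) :
  (mxvec_index s t == mxvec_index s' t') = (s == s') && (t == t').
Proof.
by rewrite /mxvec_index (inj_eq (@cast_ord_inj _ _ _)) (inj_eq enum_rank_inj).
Qed.

Section Tensor.
Variables (R : rcfType) (m n : nat).
Local Notation D := (sdim m n).
Local Notation gen := (gen m n).
Local Notation K := R[i].
Implicit Types (x y u w : gen) (h : 'rV[R]_m * 'rV[R]_n).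

Definition cartan_coef h x y : R :=
  match x with
  | inl (inl s) => h.1 0 s *+ (y == gen_q n s)
  | inl (inr s) => - (h.1 0 s *+ (y == gen_p n s))
  | inr (inl (inl t)) => h.2 0 t *+ (y == gen_s m t)
  | inr (inl (inr t)) => - (h.2 0 t *+ (y == gen_r m t))
  | inr (inr _) => 0
  end.

Lemma cartan_mxE h x y :
  cartan_mx h (gen_coord x) (gen_coord y) = cartan_coef h x y.
Proof.
have rs (t t' : 'I_n) (e e' : 'I_2) :
    (\sum_(i < n) h.2 0 i *:
          (delta_mx (mxvec_index i (0 : 'I_2)) (mxvec_index i (1 : 'I_2))
           - delta_mx (mxvec_index i (1 : 'I_2)) (mxvec_index i (0 : 'I_2))))
      (mxvec_index t e) (mxvec_index t' e') =
    h.2 0 t *+ (t == t') *+ (e' != e) * (-1) ^+ (e == 1).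
  rewrite summxE (bigD1 t) //= big1 ?addr0; last first.
    move=> t0 tt0; rewrite !mxE !mxvec_index_eq (eq_sym t) (negPf tt0) /=.
    by rewrite subrr mulr0.
  rewrite !mxE !mxvec_index_eq !eqxx /= (eq_sym t').
  case: (t == t'); rewrite ?andbF ?mulr0n ?mul0rn ?mul0r ?subrr ?mulr0 //=.
  by case: e e' => [[|[|?]] ?] [[|[|?]] ?] //=;
    rewrite ?mulr0n ?mulr1n ?subr0 ?sub0r ?subrr ?mulr1 ?mulr0 ?mul0r ?mulrN1.
move: rs; case: x => [[s|s]|[[t|t]|[]]]; case: y => [[s'|s']|[[t'|t']|[]]] rs;
  rewrite /cartan_mx /gen_coord ?block_mxEul ?block_mxEur ?block_mxEdl ?block_mxEdr
   ?block_mxEul ?block_mxEur ?block_mxEdl ?block_mxEdr ?rs ?mxE ?oppr0 ?mulr0n //=.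
all: rewrite ?mulr1n ?expr0 ?expr1 ?mul0r ?mulr1 ?mulrN1 ?mulr0n ?oppr0 //.
all: by rewrite ?(eq_sym s) ?(eq_sym t).
Qed.

(* The action of the Cartan element [h] on coordinates, [p_s] and [q_s] (and  *)
(* likewise [r_t] and [s_t]) having equal normalisations [gscale].            *)
Definition cartan_act h (c : gen -> K) x : K :=
  match x with
  | inl (inl s) => (h.1 0 s)%:C%C * c (gen_q n s)
  | inl (inr s) => - ((h.1 0 s)%:C%C * c (gen_p n s))
  | inr (inl (inl t)) => (h.2 0 t)%:C%C * c (gen_s m t)
  | inr (inl (inr t)) => - ((h.2 0 t)%:C%C * c (gen_r m t))
  | inr (inr _) => 0
  end.

Lemma cartan_mulmxE h p (T : 'M[K]_(D, p)) x k :
  (map_mx (real_complex R) (cartan_mx h) *m T) (gen_coord x) k =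
  cartan_act h (fun y => T (gen_coord y) k) x.
Proof.
have pick (a : R) y0 (F : gen -> K) :
    \sum_y (a *+ (y == y0))%:C%C * F y = a%:C%C * F y0.
  rewrite (bigD1 y0) //= eqxx big1 ?addr0 // => y /negPf->.
  by rewrite rmorph0 mul0r.
rewrite mxE (reindex (@gen_coord m n)); last exact/onW_bij/gen_coord_bij.
under eq_bigr => y _ do rewrite mxE cartan_mxE.
case: x => [[s|s]|[[t|t]|[]]] /=; rewrite ?pick //; last first.
  by rewrite big1 // => y _; rewrite rmorph0 mul0r.
all: by under eq_bigr => y _ do rewrite rmorphN mulNr; rewrite sumrN pick.
Qed.

(** Infinitesimal invariance of the form under the Cartan element, transported to B^T, the inverse
    of B. It turns the commutator with H on X into the action of H on both tensor factors of X
    B^T. *)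
Lemma cartan_formB h :
  cartan_mx h *m (Defs.formB R m n)^T = - ((Defs.formB R m n)^T *m (cartan_mx h)^T).
Proof.
rewrite /cartan_mx /Defs.formB; set U := (X in block_mx X 0 0 0).
have UT : U^T = - U.
  rewrite /U raddf_sum /= -sumrN; apply: eq_bigr => t _.
  by rewrite linearZ linearB /= !trmx_delta -scalerN opprB.
rewrite !tr_block_mx UT !trmx0 !raddfN /= !trmx1 tr_diag_mx !mulmx_block.
rewrite !(mulmx0, mul0mx, addr0, add0r, mulmx1, mul1mx, mulmxN, mulNmx).
by rewrite !opp_block_mx !opprK !oppr0.
Qed.

(** The supersymmetric coefficients of X along the m(x, y). Of the factor 4, one 2 is the one in
    [ad_m]; the other is due to m(x, y) and m(y, x) agreeing up to sign. *)
Definition tensor (X : 'M[K]_D) x y : K :=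
  (X *m (map_mx (real_complex R) (Defs.formB R m n))^T)
    (gen_coord x) (gen_coord y) / (4 * gscale R x * gscale R y)%:C%C.

Lemma tensor_weight X (a : K) h :
  (let H := map_mx (real_complex R) (cartan_mx h) in
   H *m X - X *m H = a *: X) ->
  forall x y, cartan_act h (fun z => tensor X z y) x
    + cartan_act h (fun z => tensor X x z) y = a * tensor X x y.
Proof.
move=> /= HX x y; pose B := map_mx (real_complex R) (Defs.formB R m n).
set H := map_mx _ _ in HX; pose T := X *m B^T.
have HT : H *m T + T *m H^T = a *: T.
  rewrite /T scalemxAl -HX mulmxBl !mulmxA -[X in _ = _ - X]mulmxA.
  have -> : H *m B^T = - (B^T *m H^T).
    by rewrite !map_trmx -!map_mxM cartan_formB raddfN.
  by rewrite mulmxN opprK mulmxA.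
have actT : (T *m H^T) (gen_coord x) (gen_coord y) =
    cartan_act h (fun z => T (gen_coord x) (gen_coord z)) y.
  rewrite -[T *m _]trmxK trmx_mul trmxK mxE cartan_mulmxE.
  by case: y => [[s|s]|[[t|t]|[]]] /=; rewrite ?mxE.
(* The Cartan action only mixes generators with the same [gscale], so the denominators of [tensor]
   pass through it. *)
have scale (c : gen -> K) (g : R -> K) z :
    cartan_act h (fun w => c w / g (gscale R w)) z =
    cartan_act h c z / g (gscale R z).
  by case: z => [[s|s]|[[t|t]|[]]] /=; rewrite ?mulNr ?mulrA ?mul0r.
have /matrixP/(_ (gen_coord x) (gen_coord y)) := HT.
rewrite mxE cartan_mulmxE actT [RHS]mxE => e.
rewrite /tensor -/B -/T.
rewrite (scale (fun z => T (gen_coord z) (gen_coord y))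
  (fun b => (4 * b * gscale R y)%:C%C)).
rewrite (scale (fun z => T (gen_coord x) (gen_coord z))
  (fun b => (4 * gscale R x * b)%:C%C)).
by rewrite -[LHS]mulrDl e mulrA.
Qed.
End Tensor.

(** * Weight coordinates and heights *)

Section Weight.
Variables (R : rcfType) (m n : nat).
Local Notation gen := (gen m n).
Local Notation K := R[i].
Implicit Types (x y u w : gen) (h : 'rV[R]_m * 'rV[R]_n).

(* The weights of [p - i q], [p + i q], [r - i s], [r + i s], [c], a basis of *)
(* weight vectors of [V] which is indexed by [gen] in this order.             *)
Definition gen_weight u : weight R m n := fun h =>
  match u with
  | inl (inl s) => - wt_e s h
  | inl (inr s) => wt_e s h
  | inr (inl (inl t)) => - wt_f t h
  | inr (inl (inr t)) => wt_f t h
  | inr (inr _) => 0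
  end.

(** Obtained from ap + bq = ((a + ib)/2) (p - iq) + ((a - ib)/2) (p + iq), and likewise for r and
    s. *)
Definition wcoord (c : gen -> K) u : K :=
  match u with
  | inl (inl s) => (c (gen_p n s) + 'i%C * c (gen_q n s)) / 2
  | inl (inr s) => (c (gen_p n s) - 'i%C * c (gen_q n s)) / 2
  | inr (inl (inl t)) => (c (gen_r m t) + 'i%C * c (gen_s m t)) / 2
  | inr (inl (inr t)) => (c (gen_r m t) - 'i%C * c (gen_s m t)) / 2
  | inr (inr _) => c (gen_c m n)
  end.

Lemma sqr_complexi : 'i%C * 'i%C = -1 :> K.
Proof. by rewrite -expr2 sqr_i. Qed.

Lemma wcoord_cartan h c u :
  wcoord (cartan_act h c) u = gen_weight u h * wcoord c u.
Proof.
have e1 (a x y : K) :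
    (a * y + 'i%C * - (a * x)) / 2 = - ('i%C * a) * ((x + 'i%C * y) / 2).
  transitivity ((a * - ('i%C * 'i%C) * y - 'i%C * (a * x)) / 2); last by ring.
  by rewrite sqr_complexi opprK mulr1 mulrN.
have e2 (a x y : K) :
    (a * y - 'i%C * - (a * x)) / 2 = 'i%C * a * ((x - 'i%C * y) / 2).
  transitivity ((a * - ('i%C * 'i%C) * y + 'i%C * (a * x)) / 2); last by ring.
  by rewrite sqr_complexi opprK mulr1 mulrN opprK.
by case: u => [[s|s]|[[t|t]|[]]] /=; rewrite ?e1 ?e2 ?mul0r.
Qed.

Lemma wcoord_cartan_act h (T : gen -> gen -> K) x w :
  wcoord (fun y => cartan_act h (fun z => T z y) x) w =
  cartan_act h (fun z => wcoord (T z) w) x.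
Proof.
by case: w => [[?|?]|[[?|?]|[]]] /=; case: x => [[?|?]|[[?|?]|[]]] //=; ring.
Qed.

Lemma wcoordD (c c' : gen -> K) u :
  wcoord (fun x => c x + c' x) u = wcoord c u + wcoord c' u.
Proof. by case: u => [[?|?]|[[?|?]|[]]] /=; ring. Qed.

Lemma wcoordZ a (c : gen -> K) u :
  wcoord (fun x => a * c x) u = a * wcoord c u.
Proof. by case: u => [[?|?]|[[?|?]|[]]] /=; ring. Qed.

Lemma eq_wcoord (c c' : gen -> K) u : c =1 c' -> wcoord c u = wcoord c' u.
Proof. by move=> e; case: u => [[?|?]|[[?|?]|[]]] /=; rewrite !e. Qed.

(** In weight coordinates the Cartan element acts diagonally on each tensor factor, so an
    eigentensor of eigenvalue a has component 0 at (u, w) unless the two weights add up to a. *)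
Lemma wcoord_weight h a (T : gen -> gen -> K) u w :
  (forall x y, cartan_act h (fun z => T z y) x + cartan_act h (T x) y
     = a * T x y) ->
  (gen_weight u h + gen_weight w h) * wcoord (fun x => wcoord (T x) w) u
  = a * wcoord (fun x => wcoord (T x) w) u.
Proof.
move=> e; rewrite mulrDl -wcoord_cartan -(wcoordZ (gen_weight w h)) -wcoordD.
rewrite -wcoordZ; apply: eq_wcoord => x /=; rewrite -wcoord_cartan.
rewrite -wcoordZ -wcoord_cartan_act -wcoordD; apply: eq_wcoord => y; exact: e.
Qed.

(* [i * gen_height u] is the value of the weight of [u] at a Cartan element   *)
(* where all positive roots lie in the positive imaginary half-axis, that is, *)
(* [e_1 > ... > e_m > f_1 > ... > f_n > 0].                                   *)
Definition gen_height u : int :=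
  match u with
  | inl (inl s) => - (m - s + n)%:Z
  | inl (inr s) => (m - s + n)%:Z
  | inr (inl (inl t)) => - (n - t)%:Z
  | inr (inl (inr t)) => (n - t)%:Z
  | inr (inr _) => 0
  end.

Definition height_cartan : 'rV[R]_m * 'rV[R]_n :=
  (\row_s (m - s + n)%:R, \row_t (n - t)%:R).

Lemma gen_weight_height u :
  gen_weight u height_cartan = 'i%C * (gen_height u)%:~R.
Proof.
by case: u => [[?|?]|[[?|?]|[]]] /=;
  rewrite ?mulr0 ///wt_e /wt_f /= !mxE rmorph_nat ?rmorphN ?mulrN.
Qed.

Lemma pos_root_height beta : pos_root beta ->
  exists2 k : int, 0 < k & beta height_cartan = 'i%C * k%:~R.
Proof.
have we s : wt_e s height_cartan = 'i%C * (m - s + n)%:Z%:~R.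
  exact: (gen_weight_height (gen_q n s)).
have wf t : wt_f t height_cartan = 'i%C * (n - t)%:Z%:~R.
  exact: (gen_weight_height (gen_s m t)).
case=> [s t st|s t st|s t st|s t st|t|s t|s t|s].
- exists ((m - s + n)%:Z - (m - t + n)%:Z); first by have := ltn_ord t; lia.
  by rewrite /= !we -mulrBr -rmorphB.
- exists ((m - s + n)%:Z + (m - t + n)%:Z); first by have := ltn_ord t; lia.
  by rewrite /= !we -mulrDr -rmorphD.
- exists ((n - s)%:Z - (n - t)%:Z); first by have := ltn_ord t; lia.
  by rewrite /= !wf -mulrBr -rmorphB.
- exists ((n - s)%:Z + (n - t)%:Z); first by have := ltn_ord t; lia.
  by rewrite /= !wf -mulrDr -rmorphD.
- by exists (n - t)%:Z; [have := ltn_ord t; lia|].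
- exists ((m - s + n)%:Z + (n - t)%:Z); first by have := ltn_ord t; lia.
  by rewrite /= we wf -mulrDr -rmorphD.
- exists ((m - s + n)%:Z - (n - t)%:Z).
    by have := ltn_ord s; have := ltn_ord t; lia.
  by rewrite /= we wf -mulrBr -rmorphB.
- by exists (m - s + n)%:Z; [have := ltn_ord s; lia|].
Qed.

(** At [height_cartan] a negative root is a negative integer times i, whereas the weights of u and w
    add up to a non-negative integer times i; the two differ. *)
Lemma neg_root_wcoord alpha X u w : neg_root alpha -> root_vector alpha X ->
  (0 <= gen_height u + gen_height w) ->
  wcoord (fun x => wcoord (tensor X x) w) u = 0.
Proof.
move=> [beta /pos_root_height[k k0 bk] alphaE] [_ _ HX] uw.
have := wcoord_weight u w (tensor_weight (HX height_cartan)).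
rewrite !gen_weight_height alphaE /= bk -mulrDr -mulrN -rmorphD -rmorphN.
move/eqP; rewrite -subr_eq0 -mulrBl -mulrBr -rmorphB mulf_eq0 mulf_eq0.
have i0 : ('i%C == 0 :> K) = false.
  apply/negP => /eqP i0; have /eqP := sqr_complexi.
  by rewrite i0 mulr0 eq_sym oppr_eq0 oner_eq0.
rewrite i0 intr_eq0 opprK => /orP[/eqP|/eqP//]; lia.
Qed.
End Weight.

(** * The oscillator representation in a basis of weight vectors *)

Lemma gauss_split (F : numFieldType) (a b j : F) : j * j = -1 ->
  a = (a + j * b) / 2 + (a - j * b) / 2 /\
  b = (a + j * b) / 2 * - j + (a - j * b) / 2 * j.
Proof.
move=> jj; split; first by field.
transitivity (- (j * j) * b); last by field.
by rewrite jj opprK mul1r.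
Qed.

Section FockOperators.
Variables (R : rcfType) (m n L : nat).
Local Notation D := (sdim m n).
Local Notation gen := (gen m n).
Local Notation K := R[i].
Local Notation fock := (fock R m n L).
Implicit Types (x y u w : gen) (k : 'I_L) (a b : K) (f g v : fock).

Lemma cscaleC a b f : cscale a (cscale b f) = cscale b (cscale a f).
Proof. by rewrite !cscaleM mulrC. Qed.

Lemma cscale_sum a (I : finType) (F : I -> fock) :
  cscale a (\sum_i F i) = \sum_i cscale a (F i).
Proof. exact: scaler_sumr. Qed.

Lemma cscale_scale a (c : zpoly R m L) f : cscale a (c *: f) = c *: cscale a f.
Proof. by rewrite /cscale !scalerA mulrC. Qed.

Lemma cscale_mul a f g : cscale a (f * g) = f * cscale a g.
Proof. exact: scalerAr. Qed.

Lemma sign_scaleE (e : bool) f : (-1) ^+ e *: f = cscale ((-1) ^+ e) f.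
Proof. by rewrite /cscale; case: e; rewrite ?mpolyCN mpolyC1. Qed.

(** Linearity over the complex numbers only: [zderiv] is not linear over C[z], the coefficient ring
    of the Clifford algebra. *)
Definition clinear (A : fock -> fock) :=
  (forall f g, A (f + g) = A f + A g) /\ (forall a f, A (cscale a f) = cscale a (A f)).

Lemma clinear_zderiv s k : clinear (@zderiv R m n L s k).
Proof.
split=> [f g|a f]; apply/ffunP=> S; rewrite !ffunE; first exact: linearD.
exact: mderiv_mulC.
Qed.

Lemma clinear_zmult s k : clinear (@zmult R m n L s k).
Proof. by split=> [f g|a f]; rewrite /zmult ?scalerDr ?cscale_scale. Qed.

Lemma clinear_mul f : clinear (fun g => f * g).
Proof. by split=> [g h|a g]; rewrite ?mulrDr ?cscale_mul. Qed.

Lemma clinear_flip e : clinear (@cliff_flip (zpoly R m L) (n * L + L) e).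
Proof. by split=> [f g|a f]; [exact: linearD|exact: linearZ]. Qed.

Lemma clinear_comp A B : clinear A -> clinear B -> clinear (fun f => A (B f)).
Proof. by move=> [AD AZ] [BD BZ]; split=> *; rewrite ?BD ?BZ. Qed.

Lemma clinear_id : clinear id.
Proof. by []. Qed.

Lemma clinear_scale a : clinear (@cscale R m n L a).
Proof. by split=> [f g|b f]; [exact: cscaleDr|exact: cscaleC]. Qed.

Lemma clinear_comb a b A B :
  clinear A -> clinear B -> clinear (fun f => cscale a (A f) + cscale b (B f)).
Proof.
move=> [AD AZ] [BD BZ]; split=> [f g|c f].
  by rewrite AD BD !cscaleDr addrACA.
by rewrite AZ BZ cscaleDr !(cscaleC c).
Qed.

Lemma clinear0 A : clinear A -> A 0 = 0.
Proof. by move=> [AD _]; apply: (addrI (A 0)); rewrite -AD !addr0. Qed.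

Lemma eq_clinear A B : A =1 B -> clinear A -> clinear B.
Proof. by move=> e [AD AZ]; split=> *; rewrite -!e. Qed.

(* The ladder operator of [u] is, up to the constant [gop_coef u], the action *)
(* of the weight vector of weight [gen_weight u].                             *)
Definition gop u k f : fock :=
  match u with
  | inl (inl s) => zderiv s k f
  | inl (inr s) => zmult s k f
  | inr (inl (inl t)) =>
      rgen R m t k * (f + cliff_flip (lshift L (mxvec_index t k)) f)
  | inr (inl (inr t)) =>
      rgen R m t k * (f - cliff_flip (lshift L (mxvec_index t k)) f)
  | inr (inr _) => cgen R m n k * f
  end.

Lemma clinear_gop u k : clinear (gop u k).
Proof.
have flip (a : K) (t : 'I_n) : clinear (fun f =>
    rgen R m t k * (cscale 1 f
      + cscale a (cliff_flip (lshift L (mxvec_index t k)) f))).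
  apply: clinear_comp; first exact: clinear_mul.
  by apply: clinear_comb; [exact: clinear_id|exact: clinear_flip].
case: u => [[s|s]|[[t|t]|[]]].
- exact: clinear_zderiv.
- exact: clinear_zmult.
- by apply: (eq_clinear _ (flip 1 t)) => f; rewrite !cscale1.
- by apply: (eq_clinear _ (flip (-1) t)) => f; rewrite cscaleNl !cscale1.
- exact: clinear_mul.
Qed.

Definition superbr (e : bool) (A B : 'I_L -> fock -> fock) f : fock :=
  \sum_(k < L) (A k (B k f) + (-1) ^+ e *: B k (A k f)).

Lemma superbr_sym e A B f : superbr e A B f = (-1) ^+ e *: superbr e B A f.
Proof.
rewrite /superbr scaler_sumr; apply: eq_bigr => k _.
by rewrite scalerDr scalerA -signr_addb addbb scale1r addrC.
Qed.

Lemma superbrDl e a A1 A2 B f : (forall k, clinear (B k)) ->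
  superbr e (fun k g => A1 k g + cscale a (A2 k g)) B f =
  superbr e A1 B f + cscale a (superbr e A2 B f).
Proof.
move=> linB; rewrite cscale_sum -big_split; apply: eq_bigr => k _ /=.
have [BD BZ] := linB k.
by rewrite BD BZ cscaleDr scalerDr cscale_scale addrACA.
Qed.

Lemma superbrZl e a A B f : (forall k, clinear (B k)) ->
  superbr e (fun k g => cscale a (A k g)) B f = cscale a (superbr e A B f).
Proof.
move=> linB; rewrite cscale_sum; apply: eq_bigr => k _ /=.
by rewrite (linB k).2 cscaleDr cscale_scale.
Qed.

Lemma eq_superbr e A A' B B' f : (forall k, A k =1 A' k) ->
  (forall k, B k =1 B' k) -> superbr e A B f = superbr e A' B' f.
Proof. by move=> eA eB; apply: eq_bigr => k _; rewrite !eA !eB. Qed.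

Definition wvec (F : gen -> fock) u : fock :=
  match u with
  | inl (inl s) => F (gen_p n s) + cscale (- 'i%C) (F (gen_q n s))
  | inl (inr s) => F (gen_p n s) + cscale 'i%C (F (gen_q n s))
  | inr (inl (inl t)) => F (gen_r m t) + cscale (- 'i%C) (F (gen_s m t))
  | inr (inl (inr t)) => F (gen_r m t) + cscale 'i%C (F (gen_s m t))
  | inr (inr _) => F (gen_c m n)
  end.

Lemma eq_wvec (F F' : gen -> fock) u : F =1 F' -> wvec F u = wvec F' u.
Proof. by move=> e; case: u => [[s|s]|[[t|t]|[]]] /=; rewrite !e. Qed.

Lemma wvecZ a (F : gen -> fock) u :
  wvec (fun x => cscale a (F x)) u = cscale a (wvec F u).
Proof.
by case: u => [[s|s]|[[t|t]|[]]] /=; rewrite // (cscaleC _ a) -cscaleDr.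
Qed.

Lemma wvec_sign (e : bool) (F : gen -> fock) u :
  wvec (fun x => (-1) ^+ (gen_odd x && e) *: F x) u =
  (-1) ^+ (gen_odd u && e) *: wvec F u.
Proof.
by case: u => [[s|s]|[[t|t]|[]]] //=; rewrite cscale_scale scalerDr.
Qed.

Lemma wcoord_sum (c : gen -> K) (F : gen -> fock) :
  \sum_x cscale (c x) (F x) = \sum_u cscale (wcoord c u) (wvec F u).
Proof.
have E (a b : K) (f g : fock) : cscale a f + cscale b g =
    cscale ((a + 'i%C * b) / 2) (f + cscale (- 'i%C) g)
    + cscale ((a - 'i%C * b) / 2) (f + cscale 'i%C g).
  have [] := gauss_split a b (sqr_complexi R).
  move: (_ / 2) (_ / 2) => al be -> ->.
  by rewrite !cscaleDl !cscaleDr !cscaleM addrACA.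
have sumE (I : finType) (a b : I -> K) (f g : I -> fock) :
    \sum_i cscale (a i) (f i) + \sum_i cscale (b i) (g i) =
    \sum_i cscale ((a i + 'i%C * b i) / 2) (f i + cscale (- 'i%C) (g i))
    + \sum_i cscale ((a i - 'i%C * b i) / 2) (f i + cscale 'i%C (g i)).
  by rewrite -!big_split; apply: eq_bigr => i _; exact: E.
rewrite !big_sumType /=.
have unitE : \sum_(i : unit) cscale (c (inr (inr i))) (F (inr (inr i))) =
    \sum_(i : unit) cscale (c (gen_c m n)) (F (gen_c m n)).
  by apply: eq_bigr => -[].
exact: (congr2 +%R (sumE _ _ _ _ _) (congr2 +%R (sumE _ _ _ _ _) unitE)).
Qed.

Section Rep.
Variable zeta : K.

Lemma clinear_op x k : clinear (op (R := R) zeta x k).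
Proof.
case: x => [[s|s]|[[t|t]|[]]].
- apply: (eq_clinear _ (clinear_comb ('i%C * zeta / (Num.sqrt 2)%:C%C)
   (- ('i%C * zeta / (Num.sqrt 2)%:C%C)) (clinear_zmult s k) (clinear_zderiv s k))).
  by move=> f; rewrite cscaleNl -cscaleNr -cscaleDr.
- apply: (eq_clinear _ (clinear_comb (zeta / (Num.sqrt 2)%:C%C)
   (zeta / (Num.sqrt 2)%:C%C) (clinear_zmult s k) (clinear_zderiv s k))).
  by move=> f; rewrite -cscaleDr.
- exact: clinear_mul.
- apply: (clinear_comp (clinear_scale 'i%C)).
  exact: (clinear_comp (clinear_mul _) (clinear_flip _)).
- exact: clinear_mul.
Qed.

Definition gop_coef u : K :=
  match u with
  | inl (inl _) => - (2 * ('i%C * zeta / (Num.sqrt 2)%:C%C))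
  | inl (inr _) => 2 * ('i%C * zeta / (Num.sqrt 2)%:C%C)
  | _ => 1
  end.

Lemma wvec_op u k f :
  wvec (fun x => op (R := R) zeta x k f) u = cscale (gop_coef u) (gop u k f).
Proof.
case: u => [[s|s]|[[t|t]|[]]] /=; rewrite ?cscale1 //.
- rewrite /op_p /op_q cscaleM; set a := _ / _.
  have -> : - 'i%C * (zeta / (Num.sqrt 2)%:C%C) = - a by rewrite /a !mulrA mulNr mulNr.
  rewrite cscaleNl -cscaleNr -cscaleDr opprD addrACA subrr add0r -opprD.
  by rewrite cscaleNr cscaleNl cscaleDr mulr2n mulrDl mul1r cscaleDl.
- rewrite /op_p /op_q cscaleM mulrA -cscaleDr addrACA addNr addr0.
  by rewrite cscaleDr mulr2n mulrDl mul1r cscaleDl.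
- rewrite /op_r /op_s cscaleM mulNr sqr_complexi opprK cscale1.
  by rewrite mulrDr.
- rewrite /op_r /op_s cscaleM sqr_complexi cscaleNl cscale1.
  by rewrite mulrBr.
Qed.

(** The sign depends on y through its parity alone, and the generators combined in a weight vector
    have equal parity; so the combination can be formed inside the first slot. *)
Lemma wvec_superbr B x u f : (forall k, clinear (B k)) ->
  wvec (fun y => superbr (gen_odd y && gen_odd x) (op (R := R) zeta y) B f) u
  = cscale (gop_coef u) (superbr (gen_odd u && gen_odd x) (gop u) B f).
Proof.
move=> linB; rewrite -superbrZl //.
rewrite -(@eq_superbr _ (fun k f => wvec (fun y => op (R := R) zeta y k f) u)
  _ B _ f (wvec_op u)) //.
by case: u => [[s|s]|[[t|t]|[]]] //=; rewrite superbrDl.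
Qed.

(** Change to the weight basis in both arguments. The second one is brought to the first slot by
    [superbr_sym], whose signs cancel. *)
Lemma sum_rho_m (T : gen -> gen -> K) f :
  \sum_x \sum_y cscale (T x y) (rho_m zeta x y f) =
  \sum_u \sum_w cscale (wcoord (fun x => wcoord (T x) w) u
      * (gop_coef w * gop_coef u))
    (superbr (gen_odd u && gen_odd w) (gop u) (gop w) f).
Proof.
transitivity (\sum_w \sum_x cscale (wcoord (T x) w)
    (wvec (fun y => rho_m zeta x y f) w)).
  rewrite [RHS]exchange_big; apply: eq_bigr => x _; exact: wcoord_sum.
rewrite [RHS]exchange_big; apply: eq_bigr => w _.
transitivity (\sum_u cscale (wcoord (fun x => wcoord (T x) w) u)
    (wvec (fun x => wvec (fun y => rho_m zeta x y f) w) u)).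
  exact: wcoord_sum.
apply: eq_bigr => u _; rewrite -!cscaleM; congr cscale.
have E x : wvec (fun y => rho_m zeta x y f) w = cscale (gop_coef w)
    (superbr (gen_odd x && gen_odd w) (op (R := R) zeta x) (gop w) f).
  rewrite superbr_sym cscale_scale (andbC (gen_odd x)) -wvec_superbr; last exact: clinear_op.
  have rhoE y : rho_m zeta x y f = (-1) ^+ (gen_odd y && gen_odd x) *:
      superbr (gen_odd y && gen_odd x) (op (R := R) zeta y) (op zeta x) f.
    by rewrite -superbr_sym andbC.
  by rewrite (eq_wvec _ rhoE) wvec_sign.
by rewrite (eq_wvec _ E) wvecZ wvec_superbr //; exact: clinear_gop.
Qed.

(** By [osp_repE] any coefficients C of X may be used. [tensor X] is the supersymmetrization of C,
    and supersymmetrizing leaves the sum unchanged because [rho_m] has the same symmetry. *)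
Lemma osp_rep_tensor X f : complexify (@osp R m n) X ->
  osp_rep zeta X f =
  \sum_x \sum_y cscale (tensor X x y) (rho_m zeta x y f).
Proof.
move=> [/osp_span[c cE] /osp_span[c' c'E]].
pose C x y : K := (c x y)%:C%C + 'i%C * (c' x y)%:C%C.
pose s x y : K := (-1) ^+ (@gen_odd m n x && gen_odd y).
have XE0 : X = map_mx (real_complex R) (map_mx (@complex.Re R) X)
    + 'i%C *: map_mx (real_complex R) (map_mx (@complex.Im R) X).
  by apply/matrixP=> i j; rewrite !mxE; case: (X i j) => a b; simpc.
have XE : X = \sum_x \sum_y C x y *: map_mx (real_complex R) (ad_m R x y).
  rewrite {1}XE0 cE c'E !raddf_sum -big_split; apply: eq_bigr => x _ /=.
  rewrite !raddf_sum -big_split; apply: eq_bigr => y _ /=.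
  by move: (ad_m R x y) => A; rewrite !map_mxZ scalerA -scalerDl.
have entry (a : gen -> gen -> R) x y :
    ((\sum_x \sum_y a x y *: ad_m R x y) *m (Defs.formB R m n)^T)
      (gen_coord x) (gen_coord y) =
    2 * gscale R x * gscale R y
      * (a x y + (-1) ^+ (gen_odd x && gen_odd y) * a y x).
  rewrite ad_m_expand -scalemxAl -mulmxA formB_mul_trmx mulmx1 !mxE.
  by rewrite !gen_coordK !parity_coord; ring.
have tensorE x y : tensor X x y = (C x y + s x y * C y x) / 2.
  have mapE (A A' : 'M[R]_D) i i' :
      (map_mx (real_complex R) A + 'i%C *: map_mx (real_complex R) A') i i' =
      (A i i')%:C%C + 'i%C * (A' i i')%:C%C by rewrite !mxE.
  rewrite /tensor {1}XE0 mulmxDl -scalemxAl map_trmx -!map_mxM mapE cE c'E.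
  have nz : (4 * gscale R x * gscale R y)%:C%C != 0.
    by rewrite fmorph_eq0 !mulf_neq0 ?gscale_neq0 ?pnatr_eq0.
  rewrite !entry /C /s; apply: (mulIf nz); rewrite divfK //.
  rewrite !(rmorphM, rmorphD, rmorph_sign, rmorph_nat) /=.
  by field.
pose S : fock := \sum_x \sum_y cscale (C x y) (rho_m zeta x y f).
have SE : \sum_x \sum_y cscale (s x y * C y x) (rho_m zeta x y f) = S.
  rewrite exchange_big; apply: eq_bigr => y _; apply: eq_bigr => x _ /=.
  rewrite (rho_mC zeta y x) (andbC (gen_odd y)) cscale_scale.
  rewrite sign_scaleE cscaleM mulrA /s -signr_addb addbb mul1r.
  reflexivity.
have SS : cscale 2^-1 (S + S) = S.
  have -> : S + S = cscale 2 S by rewrite [2]mulr2n cscaleDl cscale1.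
  have half : 2^-1 * 2 = 1 :> K by rewrite mulVf ?pnatr_eq0.
  rewrite cscaleM half; exact: cscale1.
transitivity (cscale 2^-1
    (S + \sum_x \sum_y cscale (s x y * C y x) (rho_m zeta x y f))).
  rewrite SE SS {1}XE; exact: osp_repE.
rewrite /S -big_split cscale_sum; apply: eq_bigr => x _ /=.
rewrite -big_split cscale_sum; apply: eq_bigr => y _ /=.
by rewrite -cscaleDl cscaleM mulrC tensorE.
Qed.
End Rep.
End FockOperators.

(** * Derivatives of the determinants *)

Section Derivation.
Variables (A : comNzRingType).
Implicit Types (p q : A).

Definition derivation (D : A -> A) :=
  (forall p q, D (p + q) = D p + D q) /\
  (forall p q, D (p * q) = D p * q + p * D q).

Lemma derivationD a D D' : derivation D -> derivation D' ->
  derivation (fun p => D p + a * D' p).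
Proof.
by move=> [DD DM] [DD' DM']; split=> p q; rewrite ?DD ?DD' ?DM ?DM'; ring.
Qed.

Lemma derivation_sum (I : finType) (a : I -> A) (D : I -> A -> A) :
  (forall i, derivation (D i)) -> derivation (fun p => \sum_i a i * D i p).
Proof.
move=> DI; split=> p q.
  by rewrite -big_split; apply: eq_bigr => i _; rewrite (DI i).1 mulrDr.
rewrite mulr_suml mulr_sumr -big_split; apply: eq_bigr => i _ /=.
by rewrite (DI i).2; ring.
Qed.

Variable D : A -> A.
Hypothesis derD : derivation D.

Lemma der0 : D 0 = 0.
Proof. by apply: (addrI (D 0)); rewrite -derD.1 !addr0. Qed.

Lemma der1 : D 1 = 0.
Proof. by apply: (addrI (D 1)); rewrite -{3}[1]mulr1 derD.2 mulr1 mul1r addr0. Qed.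

Lemma derN1 : D (-1) = 0.
Proof. by apply: (addrI (D 1)); rewrite -derD.1 subrr der0 der1 addr0. Qed.

Lemma der_sum (I : Type) (r : seq I) (P : pred I) (F : I -> A) :
  D (\sum_(i <- r | P i) F i) = \sum_(i <- r | P i) D (F i).
Proof. exact: (big_morph D derD.1 der0). Qed.

Lemma derM_eq0 p q : D p = 0 -> D q = 0 -> D (p * q) = 0.
Proof. by move=> Dp Dq; rewrite derD.2 Dp Dq mul0r mulr0 addr0. Qed.

Lemma der_prod_eq0 (I : Type) (r : seq I) (P : pred I) (F : I -> A) :
  (forall i, P i -> D (F i) = 0) -> D (\prod_(i <- r | P i) F i) = 0.
Proof.
move=> DF; apply: (big_ind (fun p => D p = 0)) => //; first exact: der1.
exact: derM_eq0.
Qed.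

Lemma derX_eq0 p k : D p = 0 -> D (p ^+ k) = 0.
Proof.
move=> Dp; elim: k => [|k IH]; first by rewrite expr0 der1.
by rewrite exprS derM_eq0.
Qed.

Lemma der_det_eq0 a (M : 'M[A]_a) :
  (forall i j, D (M i j) = 0) -> D (\det M) = 0.
Proof.
move=> DM; rewrite /determinant der_sum big1 // => s _.
by rewrite derM_eq0 ?der_prod_eq0 // derX_eq0 // derN1.
Qed.

(* [D] turns [\det M] into the determinant of [M] with row [i] replaced by a  *)
(* copy of row [i'].                                                          *)
Lemma der_det_row_eq0 a (M : 'M[A]_a) (i i' : 'I_a) : i' != i ->
  (forall k j, k != i -> D (M k j) = 0) ->
  (forall j, D (M i j) = M i' j) -> D (\det M) = 0.
Proof.
move=> ii' Dother Drow; rewrite (expand_det_row M i) der_sum.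
transitivity (\sum_j M i' j * cofactor M i j).
  apply: eq_bigr => j _; rewrite derD.2 Drow.
  suff -> : D (cofactor M i j) = 0 by rewrite mulr0 addr0.
  rewrite /cofactor derM_eq0 //; first by rewrite derX_eq0 // derN1.
  by rewrite der_det_eq0 // => k l; rewrite !mxE Dother // eq_sym neq_lift.
(* Row i' against the cofactors of row i is an off-diagonal entry of M times its adjugate. *)
have /matrixP/(_ i' i) := mul_mx_adj M.
rewrite mxE [RHS]mxE (negPf ii') mulr0n => e; rewrite -[RHS]e.
by apply: eq_bigr => j _; rewrite [in RHS]mxE.
Qed.
End Derivation.

(** * Partial derivatives, polarization and non-vanishing of Lambda *)

Section LambdaDerivation.
Variables (R : rcfType) (m L : nat).
Local Notation K := R[i].
Local Notation zpoly := (zpoly R m L).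

Definition pderiv (s : 'I_m) (k : 'I_L) (p : zpoly) : zpoly :=
  mderiv (mxvec_index s k) (p : {mpoly K[m * L]}).

Lemma pderiv_derivation s k : derivation (pderiv s k).
Proof. by split=> p q; [exact: mderivD|exact: mderivM]. Qed.

Lemma pderivC s k (a : K) : pderiv s k a%:MP = 0.
Proof. exact: mderivC. Qed.

Lemma pderiv_zvar s k s' k' :
  pderiv s k (zvar R s' k') = ((s' == s) && (k' == k))%:R.
Proof.
rewrite /pderiv /zvar mderivX mnm1E -mxvec_index_eq.
case: eqP => [->|_]; last by rewrite scale0r.
have -> : (U_(mxvec_index s k) - U_(mxvec_index s k) = 0)%MM.
  by apply/mnmP => j; rewrite mnmBE subnn mnm0E.
by rewrite mpolyX0 scale1r.
Qed.

Lemma pderiv_zvarn s k (s' k' : nat) :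
  pderiv s k (zvarn R m L s' k') = ((s' == s :> nat) && (k' == k :> nat))%:R.
Proof.
rewrite /zvarn; case: insubP => [s0 _ <-|sm]; last first.
  rewrite (der0 (pderiv_derivation s k)); case: eqP => // ss.
  by move: sm; rewrite ss ltn_ord.
case: insubP => [k0 _ <-|km]; first by rewrite pderiv_zvar.
rewrite (der0 (pderiv_derivation s k)) andbC; case: eqP => // kk.
by move: km; rewrite kk ltn_ord.
Qed.

Definition Lambda_entry (s q : nat) : zpoly :=
  zvarn R m L s q.*2 + ('i%C)%:MP * zvarn R m L s q.*2.+1.

Lemma pderiv_Lambda_entry s k (s' q : nat) :
  pderiv s k (Lambda_entry s' q) = (s' == s :> nat)%:R
   * ((q.*2 == k)%:R + ('i%C)%:MP * (q.*2.+1 == k)%:R).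
Proof.
have [DD DM] := pderiv_derivation s k.
rewrite DD DM pderivC mul0r add0r !pderiv_zvarn.
by case: (s' == s :> nat); rewrite ?mul1r // !mul0r mulr0 addr0.
Qed.

Lemma Lambda_derivation_eq0 D (i : 'I_m -> nat) : derivation D ->
  (forall a : 'I_m, i a != 0%N -> D (Lambda_minor R m L a.+1) = 0) ->
  D (Lambda R L i) = 0.
Proof.
move=> derD Da; apply: der_prod_eq0 => // a _.
have [->|ia] := eqVneq (i a) 0%N; first by rewrite expr0 der1.
by rewrite derX_eq0 // Da.
Qed.

Lemma complexMP : ('i%C)%:MP * ('i%C)%:MP = -1 :> zpoly.
Proof. by rewrite -mpolyCM -expr2 sqr_i mpolyCN mpolyC1. Qed.

(* Functions of [z_(s, 2q) + i z_(s, 2q + 1)] are killed by the derivative    *)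
(* along the isotropic vector [(1, i)].                                       *)
Lemma pderiv_isotropic_Lambda i s (q : nat) (k k' : 'I_L) :
  k = q.*2 :> nat -> k' = q.*2.+1 :> nat ->
  pderiv s k (Lambda R L i) + ('i%C)%:MP * pderiv s k' (Lambda R L i) = 0.
Proof.
move=> kq kq'; pose D p := pderiv s k p + ('i%C)%:MP * pderiv s k' p.
have derD : derivation D by apply: derivationD; exact: pderiv_derivation.
rewrite -[LHS]/(D _); apply: (Lambda_derivation_eq0 derD) => a _; apply: (der_det_eq0 derD) => p0 q0.
rewrite mxE -/(Lambda_entry _ _) /D !pderiv_Lambda_entry kq kq'.
rewrite mulrCA -mulrDr (mulrDr ('i%C)%:MP) (mulrA ('i%C)%:MP) complexMP mulN1r.
have -> : (q0.*2 == q.*2.+1) = false by lia.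
have -> : (q0.*2.+1 == q.*2) = false by lia.
by rewrite eqSS !mulr0 addr0 add0r addrN mulr0.
Qed.

(** Only minors of size at most c occur, and their entries involve only columns below 2c. *)
Lemma pderiv_Lambda_eq0 i c s (k : 'I_L) :
  (forall a : 'I_m, (c < a.+1)%N -> i a = 0%N) -> (c.*2 <= k)%N ->
  pderiv s k (Lambda R L i) = 0.
Proof.
move=> ic ck; have derD := pderiv_derivation s k.
apply: (Lambda_derivation_eq0 derD) => a ia; apply: (der_det_eq0 derD) => p0 q0.
have ac : (a < c)%N by rewrite ltnNge; apply: contraNN ia => /ic ->.
rewrite mxE -/(Lambda_entry _ _) pderiv_Lambda_entry.
have qc := ltn_ord q0.
have -> : (q0.*2 == k) = false by lia.
have -> : (q0.*2.+1 == k) = false by lia.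
by rewrite !mulr0 addr0 mulr0.
Qed.

(** The minors are taken on the bottom rows. If row s occurs in one, so does row s' below it, and
    the polarization produces two equal rows; if row s does not occur, the minor is killed
    entrywise. *)
Lemma polarization_Lambda_eq0 i (s s' : 'I_m) : (s < s')%N ->
  \sum_k zvar R s' k * pderiv s k (Lambda R L i) = 0.
Proof.
move=> ss'; pose D p := \sum_k zvar R s' k * pderiv s k p.
have derD : derivation D by apply: derivation_sum => k; exact: pderiv_derivation.
have Dz t k : D (zvarn R m L t k) = (t == s :> nat)%:R * zvarn R m L s' k.
  rewrite /D; under eq_bigr => k0 _ do rewrite pderiv_zvarn.
  case: eqP => ts /=; last by rewrite mul0r big1 // => k0 _; rewrite mulr0.
  rewrite mul1r /zvarn valK; case: insubP => [k0 _ <-|kL].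
    rewrite (bigD1 k0) //= eqxx mulr1 big1 ?addr0 // => k1 k10.
    by rewrite val_eqE eq_sym (negPf k10) mulr0.
  rewrite big1 // => k1 _; case: eqP => [kk|]; last by rewrite mulr0.
  by move: kL; rewrite kk ltn_ord.
have DC (a : K) : D a%:MP = 0.
  by rewrite /D big1 // => k _; rewrite pderivC mulr0.
have Dentry t q : D (Lambda_entry t q) = (t == s :> nat)%:R * Lambda_entry s' q.
  by rewrite derD.1 derD.2 DC mul0r add0r !Dz mulrCA -mulrDr.
rewrite -[LHS]/(D _); apply: (Lambda_derivation_eq0 derD) => a _.
have am := ltn_ord a; have sm := ltn_ord s; have sm' := ltn_ord s'.
pose M := \matrix_(p < a.+1, q < a.+1) Lambda_entry (m - a.+1 + p) q.
rewrite -/(\det M).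
have [sa|sa] := ltnP s (m - a.+1).
  apply: (der_det_eq0 derD) => p q; rewrite mxE Dentry.
  have -> : (m - a.+1 + p == s)%N = false by lia.
  by rewrite mul0r.
have p0a : (s - (m - a.+1) < a.+1)%N by lia.
have p1a : (s' - (m - a.+1) < a.+1)%N by lia.
apply: (@der_det_row_eq0 _ _ derD _ _ (Ordinal p0a) (Ordinal p1a)).
- by rewrite -val_eqE /=; lia.
- move=> p q; rewrite -val_eqE /= => ps; rewrite mxE Dentry.
  have -> : (m - a.+1 + p == s)%N = false by lia.
  by rewrite mul0r.
- move=> q; rewrite !mxE Dentry /=.
  have -> : (m - a.+1 + (s - (m - a.+1)) == s)%N = true by lia.
  have -> : (m - a.+1 + (s' - (m - a.+1)) = s')%N by lia.
  by rewrite mul1r.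
Qed.

Lemma Lambda_minor_neq0 a : (a <= m)%N -> (a.*2 <= L)%N ->
  Lambda_minor R m L a != 0.
Proof.
(* At this point row m - a + p has its only 1 in column 2p, which makes the matrix of the minor the
   identity. *)
move=> am aL; pose P : 'M[K]_(m, L) := \matrix_(s, k) (k == (s - (m - a)).*2 :> nat)%:R.
pose ev (p : {mpoly K[m * L]}) := p.@[mxvec P 0].
have evz s k : (s < m)%N -> (k < L)%N ->
    ev (zvarn R m L s k) = (k == (s - (m - a)).*2)%:R.
  move=> sm kL; rewrite /zvarn (insubT (fun i => i < m)%N sm).
  by rewrite (insubT (fun i => i < L)%N kL) /ev /= mevalXU mxvecE mxE.
have evw p q : (p < a)%N -> (q < a)%N ->
    ev (Lambda_entry (m - a + p) q) = (p == q)%:R.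
  move=> pa qa; rewrite /ev mevalD mevalM mevalC -!/(ev _) !evz; try lia.
  have -> : (m - a + p - (m - a) = p)%N by lia.
  have -> : (q.*2.+1 == p.*2) = false by lia.
  by rewrite mulr0 addr0; congr (nat_of_bool _)%:R; lia.
have : ev (Lambda_minor R m L a) = 1.
  rewrite /ev -(det_map_mx (meval (mxvec P 0))).
  transitivity (\det (1%:M : 'M[K]_a)); last exact: det1.
  congr (\det _); apply/matrixP=> p q.
  by rewrite !mxE -/(Lambda_entry _ _) [LHS]evw.
apply: contra_eqN => /eqP->; rewrite /ev meval0 eq_sym; exact: oner_neq0.
Qed.

Lemma Lambda_neq0 i : (forall a : 'I_m, (minn m L./2 < a.+1)%N -> i a = 0%N) ->
  Lambda R L i != 0.
Proof.
move=> hi; apply/prodf_neq0 => a _.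
have [/hi ->|ai] := ltnP (minn m L./2) a.+1; first by rewrite expr0 oner_neq0.
by apply/expf_neq0/Lambda_minor_neq0; lia.
Qed.
End LambdaDerivation.

(** * The primitive vector *)

Lemma pair_sum_eq0 (V : nmodType) L (F : 'I_L -> V) c : (c.*2 <= L)%N ->
  (forall q (k k' : 'I_L), (q < c)%N -> k = q.*2 :> nat -> k' = q.*2.+1 :> nat ->
     F k + F k' = 0) ->
  (forall k : 'I_L, (c.*2 <= k)%N -> F k = 0) -> \sum_k F k = 0.
Proof.
move=> cL pair0 tail0.
pose G k := if insub k is Some k' then F k' else 0.
have GE (k : 'I_L) : G k = F k by rewrite /G valK.
rewrite -(eq_bigr _ (fun k _ => GE k)) -(big_mkord xpredT G).
rewrite (big_cat_nat (n := c.*2)) //=.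
rewrite [X in _ + X]big_nat [X in _ + X]big1 ?addr0; last first.
  by move=> k /andP[ck kL]; rewrite (GE (Ordinal kL)) tail0.
elim: c cL pair0 {tail0} => [|c IH] cL pair0; first by rewrite big_nil.
rewrite doubleS !big_nat_recr //= IH; last first.
- by move=> q k k' qc; apply: pair0; lia.
- by lia.
have k0 : (c.*2 < L)%N by lia.
have k1 : (c.*2.+1 < L)%N by lia.
rewrite add0r (GE (Ordinal k0)) (GE (Ordinal k1)); exact: (pair0 c).
Qed.

(** * A criterion for a superbracket to kill a vector *)

Section FockKill.
Variables (R : rcfType) (m n L : nat).
Local Notation gen := (gen m n).
Local Notation K := R[i].
Local Notation fock := (fock R m n L).
Local Notation zpoly := (zpoly R m L).
Local Notation I := (('i%C)%:MP : zpoly).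
Implicit Types (u w : gen) (k : 'I_L) (f v : fock).

Definition pair_kill u c v := forall q k k', (q < c)%N ->
  k = q.*2 :> nat -> k' = q.*2.+1 :> nat ->
  gop u k v + cscale 'i%C (gop u k' v) = 0.

Lemma pair_kill_le u c c' v : (c' <= c)%N -> pair_kill u c v -> pair_kill u c' v.
Proof. by move=> cc uv q k k' qc; apply: uv; apply: leq_trans cc. Qed.

(** With x_k, y_k the actions of u and w on copy k and k' = k + 1, x_k v = -i x_k' v and y_k v = -i
    y_k' v; commuting twice gives x_k y_k v = (-i)^2 x_k' y_k' v. Both orders of the product sum to
    0 separately, so [e] is independent of the commutation sign [eps]. *)
Lemma superbr_kill e (eps : bool) u w c v : (c.*2 <= L)%N ->
  (forall k k' f, gop u k (gop w k' f) = cscale ((-1) ^+ eps) (gop w k' (gop u k f))) ->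
  pair_kill u c v -> pair_kill w c v ->
  (forall k, (c.*2 <= k)%N -> gop u k v = 0 \/ gop w k v = 0) ->
  superbr e (gop u) (gop w) v = 0.
Proof.
move=> cL comm uv wv tail.
have comm' k f : gop w k (gop u k f) = cscale ((-1) ^+ eps) (gop u k (gop w k f)).
  by rewrite comm cscaleM -signr_addb addbb cscale1.
have zero a : cscale a (0 : fock) = 0 by exact: scaler0.
have linu k := @clinear_gop R m n L u k.
have linw k := @clinear_gop R m n L w k.
apply: pair_sum_eq0 cL _ _ => [q k k' qc kq kq'|k ck]; last first.
  rewrite comm'; suff -> : gop u k (gop w k v) = 0.
    by rewrite zero scaler0 addr0.
  case: (tail k ck) => [u0|w0].
    by rewrite comm u0 (clinear0 (linw k)) zero.
  by rewrite w0 (clinear0 (linu k)).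
suff uw : gop u k (gop w k v) + gop u k' (gop w k' v) = 0.
  rewrite addrACA uw !comm' -scalerDr -cscaleDr uw zero scaler0 addr0.
  by [].
have /(canRL (addrK _)) := uv q k k' qc kq kq'; rewrite add0r -cscaleNl => uE.
have /(canRL (addrK _)) := wv q k k' qc kq kq'; rewrite add0r -cscaleNl => wE.
rewrite wE (linu k).2 comm uE (linw k').2 !cscaleM comm -cscaleDl.
have -> : - 'i%C * (-1) ^+ eps * - 'i%C + (-1) ^+ eps = 0 :> K.
  by rewrite mulrAC mulrNN sqr_complexi mulN1r addNr.
exact: cscale0.
Qed.

Definition odd_index (o : 'I_n + 'I_n + unit) k : 'I_(n * L + L) :=
  match o with
  | inl (inl t) | inl (inr t) => lshift L (mxvec_index t k)
  | inr _ => rshift (n * L) k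
  end.

Definition odd_sign (o : 'I_n + 'I_n + unit) : zpoly :=
  match o with inl (inl _) => 1 | inl (inr _) => -1 | inr _ => 0 end.

Lemma gop_ladder o k f :
  gop (inr o) k f = cliff_ladder (odd_index o k) (odd_sign o) f.
Proof.
rewrite /cliff_ladder; case: o => [[t|t]|[]] /=.
- by rewrite scale1r.
- by rewrite scaleN1r.
- by rewrite scale0r addr0.
Qed.

Lemma gop_odd_comm o o' k k' f : odd_index o k != odd_index o' k' ->
  gop (inr o) k (gop (inr o') k' f) =
  cscale ((-1) ^+ true) (gop (inr o') k' (gop (inr o) k f)).
Proof.
move=> oo; rewrite !gop_ladder cliff_ladder_anticomm //.
by rewrite -sign_scaleE scaleN1r.
Qed.

Lemma zderivE s k f S : zderiv s k f S = pderiv s k (f S).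
Proof. by rewrite ffunE. Qed.

(** The structure constants of the Clifford product are signs, hence constants for the derivation of
    C[z]. *)
Lemma zderivM s k f g : zderiv s k (f * g) = zderiv s k f * g + f * zderiv s k g.
Proof.
have derD := @pderiv_derivation R m L s k.
apply/ffunP=> S; rewrite zderivE !ffunE (der_sum derD) -big_split.
apply: eq_bigr => A _; rewrite derD.2 derD.2 !zderivE.
have -> : pderiv s k (reorder_sign zpoly A (symdiff A S)) = 0.
  rewrite /reorder_sign (der_prod_eq0 derD) // => a _.
  rewrite (der_prod_eq0 derD) // => b _; exact: derN1 derD.
by rewrite mul0r add0r mulrDr.
Qed.

Lemma zderiv_gen s k (g : 'I_(n * L + L)) :
  zderiv s k (cliff_gen zpoly g : fock) = 0.
Proof.
apply/ffunP=> S; rewrite zderivE !ffunE.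
have derD := @pderiv_derivation R m L s k.
by case: (S == _); [exact: der1 derD|exact: der0 derD].
Qed.

Lemma zderiv_scale s k (p : zpoly) f :
  zderiv s k (p *: f) = pderiv s k p *: f + p *: zderiv s k f.
Proof.
have derD := @pderiv_derivation R m L s k.
by apply/ffunP=> S; rewrite zderivE !ffunE derD.2.
Qed.

Lemma zderiv_flip s k g f :
  zderiv s k (cliff_flip g f) = cliff_flip g (zderiv s k f).
Proof.
have derD := @pderiv_derivation R m L s k.
apply/ffunP=> S; rewrite zderivE !ffunE derD.2.
by rewrite (derX_eq0 derD) ?mul0r ?add0r //; exact: derN1 derD.
Qed.

Lemma gop_even_odd_comm s o k k' f :
  gop (gen_p n s) k (gop (inr o) k' f) =
  cscale ((-1) ^+ false) (gop (inr o) k' (gop (gen_p n s) k f)).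
Proof.
rewrite !gop_ladder expr0 cscale1 /cliff_ladder /= zderivM zderiv_gen mul0r add0r.
rewrite (@clinear_zderiv R m n L s k).1 zderiv_scale zderiv_flip.
have derD := @pderiv_derivation R m L s k.
have -> : pderiv s k (odd_sign o) = 0.
  by case: o => [[t|t]|[]]; [exact: der1 derD|exact: derN1 derD|exact: der0 derD].
by rewrite scale0r add0r.
Qed.

Lemma gop_even_comm s s' k k' f :
  gop (gen_p n s) k (gop (gen_p n s') k' f) =
  cscale ((-1) ^+ false) (gop (gen_p n s') k' (gop (gen_p n s) k f)).
Proof.
rewrite expr0 cscale1; apply/ffunP=> S; rewrite !zderivE; exact: mderiv_comm.
Qed.
End FockKill.

Lemma mulr_nest (A : pzRingType) (a b x c : A) : a * (b * x * c) = a * b * x * c.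
Proof. by rewrite !mulrA. Qed.

Lemma mulr_nestr (A : pzRingType) (a b x c y z : A) :
  a * (b * x * c * y) * z = a * b * x * (c * y * z).
Proof. by rewrite !mulrA. Qed.

Lemma mulr_nestl (A : pzRingType) (a y b x c z : A) :
  a * (y * (b * x * c)) * z = a * (y * b) * x * (c * z).
Proof. by rewrite !mulrA. Qed.

(** * The vector Lambda R and the operators that kill it *)

Section Vector.
Variables (R : rcfType) (m n L : nat) (i : 'I_m -> nat) (j : 'I_n -> nat).
Hypothesis hj : forall b, (j b <= L./2)%N.
Hypothesis hi : forall a : 'I_m, (minn m L./2 < a.+1)%N -> i a = 0%N.
Hypothesis hj_mono : forall b b' : 'I_n, (b <= b')%N -> (j b <= j b')%N.
Hypothesis hij : forall (b : 'I_n) (a : 'I_m),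
  val b = 0%N -> (j b < a.+1)%N -> i a = 0%N.
Local Notation gen := (gen m n).
Local Notation K := R[i].
Local Notation fock := (fock R m n L).
Local Notation zpoly := (zpoly R m L).
Local Notation I := (('i%C)%:MP : zpoly).
Implicit Types (u w : gen) (k : 'I_L) (f : fock).
Let rvec : fock := Rvector R m L j.
Let v : fock := Lambda R L i *: rvec.

Definition r_index (b : 'I_n) k : 'I_(n * L + L) := lshift L (mxvec_index b k).
Definition c_index k : 'I_(n * L + L) := rshift (n * L) k.

Lemma r_index_inj b : injective (r_index b).
Proof. by move=> k k' /lshift_inj/eqP; rewrite mxvec_index_eq eqxx => /eqP. Qed.

Lemma r_index_neq b b' k k' : b != b' -> r_index b k != r_index b' k'.
Proof.
by move=> bb; rewrite (inj_eq (@lshift_inj _ _)) mxvec_index_eq (negPf bb).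
Qed.

Lemma rc_index_neq b k k' : r_index b k != c_index k'.
Proof. by rewrite eq_lrshift. Qed.

Lemma c_index_inj : injective c_index.
Proof. exact: rshift_inj. Qed.

Lemma RfactorE b c : Rfactor R m L b c =
  (\prod_(0 <= p < c) line_pair (r_index b) I p)
  * \prod_(c.*2 <= p < L) line_gen zpoly (r_index b) p.
Proof. by []. Qed.

Lemma CfactorE : Cfactor R m n L =
  \prod_(0 <= p < L./2) line_pair c_index I p.
Proof. by []. Qed.

Lemma avoids_Rfactor (G : {pred 'I_(n * L + L)}) b c :
  (forall k, r_index b k \notin G) -> avoids G (Rfactor R m L b c).
Proof.
move=> bG; rewrite RfactorE; apply: avoidsM; apply: avoids_prod => p _.
  by apply: avoids_line_pair => k _.
by apply: avoids_line_gen => k _.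
Qed.

Lemma avoids_Cfactor (G : {pred 'I_(n * L + L)}) :
  (forall k, c_index k \notin G) -> avoids G (Cfactor R m n L).
Proof.
move=> cG; rewrite CfactorE; apply: avoids_prod => p _.
by apply: avoids_line_pair => k _.
Qed.

(** The product does not commute, so block b is isolated by splitting the enumeration of the blocks;
    as it has no repetition, b is absent on either side. *)
Lemma Rvector_factor b (G : {pred 'I_(n * L + L)}) :
  (forall k, c_index k \notin G) ->
  (forall b' k, b' != b -> r_index b' k \notin G) ->
  exists A B, [/\ avoids G A, avoids G B & rvec = A * Rfactor R m L b (j b) * B].
Proof.
move=> cG rG; have bs : b \in index_enum 'I_n by rewrite mem_index_enum.
have us := index_enum_uniq 'I_n.
rewrite /rvec /Rvector; case/splitPr: bs us => s1 s2.
rewrite cat_uniq /= negb_or => /and3P[_ /andP[bs1 _] /andP[bs2 _]].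
have av s : b \notin s ->
    avoids G (\prod_(b' <- s) Rfactor R m L b' (j b')).
  move=> bs; rewrite big_seq; apply: avoids_prod => b' b's.
  apply: avoids_Rfactor => k; apply: rG.
  by apply: contraNneq bs => <-.
exists (\prod_(b' <- s1) Rfactor R m L b' (j b')).
exists ((\prod_(b' <- s2) Rfactor R m L b' (j b')) * Cfactor R m n L).
split; [exact: av|by apply: avoidsM; [exact: av|exact: avoids_Cfactor]|].
rewrite big_cat big_cons.
exact: etrans (congr1 (fun f : fock => f * _) (mulrA _ _ _)) (esym (mulrA _ _ _)).
Qed.

Lemma Rvector_Cfactor (G : {pred 'I_(n * L + L)}) :
  (forall b k, r_index b k \notin G) ->
  exists2 A, avoids G A & rvec = A * Cfactor R m n L.
Proof.
move=> rG; exists (\prod_(b < n) Rfactor R m L b (j b)) => //.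
by apply: avoids_prod => b _; exact: avoids_Rfactor.
Qed.

Lemma odd_pair_kill o k k' A B :
  odd_index o k != odd_index o k' ->
  avoids (pred2 (odd_index o k) (odd_index o k')) A ->
  avoids (pred2 (odd_index o k) (odd_index o k')) B ->
  rvec = A * (cliff_gen _ (odd_index o k) + I *: cliff_gen _ (odd_index o k')) * B ->
  gop (inr o) k v + cscale 'i%C (gop (inr o) k' v) = 0.
Proof.
move=> kk aA aB rE; rewrite !gop_ladder /v !cliff_ladderZ cscale_scale -scalerDr.
rewrite rE /cscale (isotropic_factor (complexMP R m L) _ kk aA aB).
exact: scaler0.
Qed.

Lemma r_pair_kill o b : o = inl b \/ o = inr b ->
  pair_kill (inr (inl o)) (j b) v.
Proof.
move=> ob q k k' qj kq kq'.
have oE : odd_index (inl o) =1 r_index b by case: ob => ->.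
have kk : k != k' by rewrite -val_eqE /= kq kq'; lia.
have rr : r_index b k != r_index b k' by rewrite (inj_eq (@r_index_inj b)).
pose G := pred2 (r_index b k) (r_index b k').
have [A [B [aA aB AB]]] := line_pairs_factor (@r_index_inj b) I kq kq' qj.
have [|b' k0 bb|A' [B' [aA' aB' AB']]] := @Rvector_factor b G.
- by move=> k0; rewrite !inE !(eq_sym (c_index _)) !negb_or !rc_index_neq.
- by rewrite !inE negb_or !r_index_neq.
apply: (@odd_pair_kill _ k k' (A' * A)
  (B * (\prod_((j b).*2 <= p < L) line_gen zpoly (r_index b) p) * B')).
- by rewrite !oE.
- rewrite !oE; exact: avoidsM aA' aA.
- rewrite !oE; apply: avoidsM aB'; apply: avoidsM aB _.
  rewrite big_nat; apply: avoids_prod => p /andP[jp _].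
  apply: avoids_line_gen => k0 k0p.
  by rewrite inE !(inj_eq (@r_index_inj b)) -!val_eqE /= k0p kq kq'; lia.
- rewrite !oE AB' RfactorE AB; exact: mulr_nestr.
Qed.

Lemma r_tail_kill b k : ((j b).*2 <= k)%N -> gop (gen_r m b) k v = 0.
Proof.
move=> jk; have [A [B [aA aB AB]]] := line_singles_factor zpoly (@r_index_inj b) jk.
have [|b' k0 bb|A' [B' [aA' aB' AB']]] := @Rvector_factor b (pred1 (r_index b k)).
- by move=> k0; rewrite inE eq_sym rc_index_neq.
- by rewrite inE r_index_neq.
pose P := A' * ((\prod_(0 <= p < j b) line_pair (r_index b) I p) * A).
have aP : avoids (pred1 (r_index b k)) P.
  apply: (avoidsM aA'); apply: avoidsM aA; rewrite big_nat.
  apply: avoids_prod => p /andP[_ pj]; apply: avoids_line_pair => k0 k0p.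
  by rewrite inE (inj_eq (@r_index_inj b)) -val_eqE /=; lia.
have rE : rvec = P * cliff_gen zpoly (r_index b k) * (B * B').
  rewrite AB' RfactorE AB; exact: mulr_nestl.
have flipE : cliff_flip (r_index b k) rvec = - rvec.
  rewrite rE; exact: odd_factor aP (avoidsM aB aB').
rewrite (gop_ladder (inl (inl b))) /v cliff_ladderZ /cliff_ladder /=.
rewrite scale1r [cliff_flip _ _]flipE addrN mulr0; exact: scaler0.
Qed.

Lemma c_pair_kill : pair_kill (gen_c m n) L./2 v.
Proof.
move=> q k k' qj kq kq'.
have kk : k != k' by rewrite -val_eqE /= kq kq'; lia.
have [A [B [aA aB AB]]] := line_pairs_factor c_index_inj I kq kq' qj.
have [|A' aA' AB'] := @Rvector_Cfactor (pred2 (c_index k) (c_index k')).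
  by move=> b k0; rewrite !inE !negb_or !rc_index_neq.
apply: (@odd_pair_kill (inr tt) k k' _ _ _ (avoidsM aA' aA) aB).
- by rewrite (inj_eq c_index_inj).
- rewrite AB' CfactorE AB; exact: mulr_nest.
Qed.

Lemma zderiv_Rvector s k : zderiv s k rvec = 0.
Proof.
have [zD zZ] := @clinear_zderiv R m n L s k.
have zM f g : zderiv s k f = 0 -> zderiv s k g = 0 -> zderiv s k (f * g) = 0.
  by move=> f0 g0; rewrite zderivM f0 g0 mul0r mulr0 addr0.
have z0 : zderiv s k (0 : fock) = 0 by exact: clinear0.
have z1 : zderiv s k (1 : fock) = 0.
  apply: (addrI (zderiv s k (1 : fock))).
  by rewrite addr0 -{3}[1 : fock]mul1r zderivM mulr1 mul1r.
have zprod (r : seq nat) (P : pred nat) (F : nat -> fock) :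
    (forall p, P p -> zderiv s k (F p) = 0) ->
    zderiv s k (\prod_(p <- r | P p) F p) = 0.
  exact: (big_ind (fun f : fock => zderiv s k f = 0) z1 zM).
have zgen (e : 'I_L -> 'I_(n * L + L)) p :
    zderiv s k (line_gen zpoly e p : fock) = 0.
  by rewrite /line_gen; case: insub => [k'|]; [exact: zderiv_gen|exact: z0].
have zpair (e : 'I_L -> 'I_(n * L + L)) p :
    zderiv s k (line_pair e I p : fock) = 0.
  rewrite /line_pair zD zgen add0r -/(cscale 'i%C _) zZ zgen; exact: scaler0.
have zR b : zderiv s k (Rfactor R m L b (j b)) = 0.
  rewrite RfactorE; apply: (zM _ _ (zprod _ _ _ _) (zprod _ _ _ _)) => p _.
    exact: zpair.
  exact: zgen.
have zC : zderiv s k (Cfactor R m n L) = 0.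
  by rewrite CfactorE; apply: zprod => p _; exact: zpair.
apply: (zM _ _ _ zC).
exact: (big_ind (fun f : fock => zderiv s k f = 0) z1 zM (fun b _ => zR b)).
Qed.

Lemma gop_p_vector s k :
  gop (gen_p n s) k v = pderiv s k (Lambda R L i) *: rvec.
Proof. by rewrite /= /v zderiv_scale zderiv_Rvector scaler0 addr0. Qed.

Lemma p_pair_kill s c : pair_kill (gen_p n s) c v.
Proof.
move=> q k k' _ kq kq'; rewrite !gop_p_vector /cscale scalerA -scalerDl.
by rewrite (pderiv_isotropic_Lambda R i s kq kq') scale0r.
Qed.

Lemma p_tail_kill s k c : (forall a : 'I_m, (c < a.+1)%N -> i a = 0%N) ->
  (c.*2 <= k)%N -> gop (gen_p n s) k v = 0.
Proof. by move=> ic ck; rewrite gop_p_vector (pderiv_Lambda_eq0 R s ic ck) scale0r. Qed.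

(** By monotonicity the first block has the smallest j, so the bound assumed for it holds for every
    block. *)
Lemma Lambda_exponents_le b (a : 'I_m) : (j b < a.+1)%N -> i a = 0%N.
Proof.
move=> ja; have n0 : (0 < n)%N by apply: leq_trans (ltn_ord b).
apply: (hij (b := Ordinal n0)) => //; apply: leq_ltn_trans ja.
exact: hj_mono.
Qed.

Lemma Lambda_exponents_le_half (a : 'I_m) : (L./2 < a.+1)%N -> i a = 0%N.
Proof. by move=> la; apply: hi; rewrite gtn_min la orbT. Qed.

Lemma half_le : (L./2.*2 <= L)%N. Proof. by lia. Qed.

Lemma j_le b : ((j b).*2 <= L)%N.
Proof. by have := hj b; lia. Qed.

Lemma superbr_pp s s' e : superbr e (gop (gen_p n s)) (gop (gen_p n s')) v = 0.
Proof.
apply: superbr_kill half_le _ _ _ _; first exact: gop_even_comm.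
- exact: p_pair_kill.
- exact: p_pair_kill.
- by move=> k lk; left; apply: p_tail_kill lk; exact: Lambda_exponents_le_half.
Qed.

Lemma superbr_pq (s s' : 'I_m) e : (s < s')%N ->
  superbr e (gop (gen_p n s)) (gop (gen_q n s')) v = 0.
Proof.
move=> ss; have comm k f : gop (gen_p n s) k (gop (gen_q n s') k f) =
    gop (gen_q n s') k (gop (gen_p n s) k f).
  rewrite /= /zmult zderiv_scale pderiv_zvar -val_eqE.
  by rewrite (gtn_eqF ss) scale0r add0r.
have sum0 : \sum_k gop (gen_q n s') k (gop (gen_p n s) k v) = 0.
  transitivity ((\sum_k zvar R s' k * pderiv s k (Lambda R L i)) *: rvec).
    by rewrite scaler_suml; apply: eq_bigr => k _; rewrite gop_p_vector -scalerA.
  by rewrite (polarization_Lambda_eq0 R L i ss) scale0r.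
have sum0' : \sum_k gop (gen_p n s) k (gop (gen_q n s') k v) = 0.
  by rewrite -[RHS]sum0; apply: eq_bigr => k _; exact: comm.
transitivity (\sum_k gop (gen_p n s) k (gop (gen_q n s') k v)
    + (-1) ^+ e *: \sum_k gop (gen_q n s') k (gop (gen_p n s) k v)).
  by rewrite scaler_sumr -big_split.
rewrite sum0 sum0' scaler0; exact: addr0.
Qed.

(** The cut is at j_b: from copy 2 j_b on, Lambda has no variable, since its minors have size at
    most j_1 <= j_b. *)
Lemma superbr_pr s o b e : o = inl b \/ o = inr b ->
  superbr e (gop (gen_p n s)) (gop (inr (inl o))) v = 0.
Proof.
move=> ob; apply: superbr_kill (j_le b) _ _ _ _; first exact: gop_even_odd_comm.
- exact: p_pair_kill.
- exact: r_pair_kill.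
- by move=> k jk; left; apply: p_tail_kill jk; exact: Lambda_exponents_le.
Qed.

Lemma superbr_pc s e : superbr e (gop (gen_p n s)) (gop (gen_c m n)) v = 0.
Proof.
apply: superbr_kill half_le _ _ _ _; first exact: gop_even_odd_comm.
- exact: p_pair_kill.
- exact: c_pair_kill.
- by move=> k lk; left; apply: p_tail_kill lk; exact: Lambda_exponents_le_half.
Qed.

(** The cut is at the smaller of j_b and j_b'; from there on the corresponding block has only
    unpaired factors, killed by its r - is. *)
Lemma superbr_rr b b' e : b != b' ->
  superbr e (gop (gen_r m b)) (gop (gen_r m b')) v = 0.
Proof.
move=> bb.
have cL : ((minn (j b) (j b')).*2 <= L)%N by have := j_le b; lia.
apply: superbr_kill cL _ _ _ _.
- by move=> k k' f; apply: gop_odd_comm; exact: r_index_neq.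
- by apply: pair_kill_le (r_pair_kill (or_introl erefl)); rewrite geq_minl.
- by apply: pair_kill_le (r_pair_kill (or_introl erefl)); rewrite geq_minr.
- move=> k; case: (leqP (j b) (j b')) => jj jk; [left|right].
    exact: r_tail_kill.
  exact: r_tail_kill.
Qed.

(** r + is kills v only in pairs, up to j_b'; monotonicity makes this reach j_b, where r - is of
    block b takes over. *)
Lemma superbr_rs (b b' : 'I_n) e : (b < b')%N ->
  superbr e (gop (gen_r m b)) (gop (gen_s m b')) v = 0.
Proof.
move=> bb; apply: superbr_kill (j_le b) _ _ _ _.
- move=> k k' f; apply: gop_odd_comm; apply: r_index_neq.
  by rewrite -val_eqE /= (ltn_eqF bb).
- exact: r_pair_kill (or_introl erefl).
- by apply: pair_kill_le (r_pair_kill (or_intror erefl)); apply/hj_mono/ltnW.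
- by move=> k jk; left; exact: r_tail_kill.
Qed.

Lemma superbr_rc b e : superbr e (gop (gen_r m b)) (gop (gen_c m n)) v = 0.
Proof.
apply: superbr_kill (j_le b) _ _ _ _.
- by move=> k k' f; apply: gop_odd_comm; exact: rc_index_neq.
- exact: r_pair_kill (or_introl erefl).
- exact: pair_kill_le (hj b) c_pair_kill.
- by move=> k jk; left; exact: r_tail_kill.
Qed.

Lemma superbr_self u : superbr true (gop u) (gop u) v = 0.
Proof. by rewrite /superbr big1 // => k _; rewrite scaleN1r addrN. Qed.

(** Up to order, the pairs of negative height are those treated above; in every other case the
    height condition is contradictory. *)
Lemma superbr_negative u w : gen_height u + gen_height w < 0 ->
  superbr (gen_odd u && gen_odd w) (gop u) (gop w) v = 0.
Proof.
have sym e u' w' : superbr e (gop w') (gop u') v = 0 ->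
    superbr e (gop u') (gop w') v = 0.
  by move=> wu; rewrite superbr_sym wu; exact: scaler0.
case: u => [[s|s]|[[t|t]|[]]]; case: w => [[s'|s']|[[t'|t']|[]]] /= ht.
- exact: superbr_pp.
- by apply: superbr_pq; have := ltn_ord s; have := ltn_ord s'; lia.
- by apply: superbr_pr; left.
- by apply: superbr_pr; right.
- exact: superbr_pc.
- by apply/sym/superbr_pq; have := ltn_ord s; have := ltn_ord s'; lia.
- by move: ht; lia.
- by move: ht; have := ltn_ord s; lia.
- by move: ht; lia.
- by move: ht; lia.
- by apply/sym/superbr_pr; left.
- by move: ht; have := ltn_ord s'; lia.
- have [->|tt] := eqVneq t t'; [exact: superbr_self|exact: superbr_rr].
- by apply: superbr_rs; have := ltn_ord t; have := ltn_ord t'; lia.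
- exact: superbr_rc.
- by apply/sym/superbr_pr; right.
- by move: ht; lia.
- by apply/sym/superbr_rs; have := ltn_ord t; have := ltn_ord t'; lia.
- by move: ht; lia.
- by move: ht; lia.
- exact/sym/superbr_pc.
- by move: ht; lia.
- exact/sym/superbr_rc.
- by move: ht; lia.
- by move: ht; lia.
Qed.

Lemma Rvector_neq0 : rvec != 0.
Proof.
have half : (2^-1)%:MP + (2^-1)%:MP = 1 :> zpoly.
  have half : 2^-1 + 2^-1 = 1 :> K.
    by rewrite -mulr2n -[_ *+ 2]mulr_natl mulfV ?pnatr_eq0.
  by rewrite -mpolyCD half mpolyC1.
(* Blocks are peeled off from the left: the pairs of block b use no generator of its singles, of
   later blocks or of x, and the singles are invertible. *)
have Rfac0 (s : seq 'I_n) x : uniq s -> x != 0 ->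
    (forall b k, b \in s -> cliff_flip (r_index b k) x = x) ->
    (\prod_(b <- s) Rfactor R m L b (j b)) * x != 0.
  elim: s => [|b s IH] /=; first by rewrite big_nil mul1r.
  move=> /andP[bs us] x0 fx; rewrite big_cons -mulrA RfactorE -mulrA.
  have y0 : (\prod_(b <- s) Rfactor R m L b (j b)) * x != 0.
    by apply: IH => // b' k b's; apply: fx; rewrite inE b's orbT.
  apply: (line_pairs_mul_neq0 half (@r_index_inj b) I (j_le b)).
    move=> k kj; have [fS _] : avoids (pred1 (r_index b k))
        (\prod_((j b).*2 <= p < L) line_gen zpoly (r_index b) p).
      rewrite big_nat; apply: avoids_prod => p /andP[jp _].
      apply: avoids_line_gen => k' k'p.
      by rewrite inE (inj_eq (@r_index_inj b)) -val_eqE /=; lia.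
    have [fR _] : avoids (pred1 (r_index b k))
        (\prod_(b <- s) Rfactor R m L b (j b)).
      rewrite big_seq; apply: avoids_prod => b' b's.
      apply: avoids_Rfactor => k'; rewrite inE r_index_neq //.
      by apply: contraNneq bs => <-.
    have kk : r_index b k \in pred1 (r_index b k) by rewrite inE.
    have fb := fx b k (mem_head b s).
    by rewrite !cliff_flipM fb (fS _ kk) (fR _ kk).
  exact: line_singles_mul_neq0.
apply: Rfac0; first exact: index_enum_uniq.
  rewrite CfactorE -[X in X != 0]mulr1.
  apply: (line_pairs_mul_neq0 half c_index_inj I half_le); last exact: oner_neq0.
  by move=> k _; exact: cliff_flip1.
move=> b k _; have [k'|fC _] := @avoids_Cfactor (pred1 (r_index b k)).
  by rewrite inE eq_sym rc_index_neq.
by apply: fC; rewrite inE.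
Qed.

(** Scaling by Lambda multiplies each Clifford coefficient in the domain C[z], so it suffices that
    Lambda and R are non-zero. *)
Lemma vector_neq0 : v != 0.
Proof.
have /eqP := Rvector_neq0; apply: contra_notN => /eqP v0.
apply/ffunP=> S; rewrite [RHS]ffunE; apply/eqP.
have /ffunP/(_ S) := v0; rewrite [LHS]ffunE [RHS]ffunE => /eqP.
have L0 := Lambda_neq0 R hi.
by rewrite [_ == _]mulf_eq0 => /orP[/eqP L1|//]; rewrite L1 eqxx in L0.
Qed.

Lemma primitive_vector zeta : primitive zeta v.
Proof.
split; first exact: vector_neq0.
move=> alpha X alphaN rootX; have [ospX _ _] := rootX.
rewrite osp_rep_tensor // sum_rho_m; apply: big1 => u _; apply: big1 => w _.
have [uw|uw] := lerP 0 (gen_height u + gen_height w).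
  by rewrite (neg_root_wcoord alphaN rootX uw) mul0r cscale0.
by rewrite superbr_negative //; exact: scaler0.
Qed.
End Vector.

Theorem proposition3p1 (R : realType) (m n L : nat) (zeta : R[i])
  (i : 'I_m -> nat) (j : 'I_n -> nat)
  (hzeta : zeta ^+ 2 = 'i%C)
  (hL : (1 <= L)%N)
  (hj : forall b : 'I_n, (j b <= L./2)%N)
  (hi : forall a : 'I_m, (minn m L./2 < a.+1)%N -> i a = 0%N)
  (hj_mono : forall b b' : 'I_n, (b <= b')%N -> (j b <= j b')%N)
  (hij : forall (b : 'I_n) (a : 'I_m), val b = 0%N -> (j b < a.+1)%N -> i a = 0%N) :
  primitive zeta (Lambda R L i *: Rvector R m L j).
Proof. exact: primitive_vector. Qed.
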